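(* Let $N\ge 2$, $2\le p<N$, $r_0>0$, $\lambda\in[0,C_H]$ where $C_H=\left|\frac{p-N}{p}\right|^p$, and consider the equation $$-\Delta_p u-\frac{\lambda}{|x|^p}|u|^{p-2}u=0\quad\text{in }B]r_0,\infty[.$$ Let $\alpha_\lambda\le\bar\alpha_\lambda$ be the roots in $\left[\frac{p-N}{p-1},0\right]$ of $\alpha|\alpha|^{p-2}\big(p-N-(p-1)\alpha\big)=\lambda$. Then: (a) for every positive (not necessarily radial or decreasing) $C^2$-supersolution $w$ of the equation there is $C>0$ with $|x|^{\alpha_\lambda}\le C\,w(x)$ for all $x\in B[r_0,\infty[$; (b) for every positive radial strictly monotone decreasing $C^2$-supersolution $v$ of the equation: if $\lambda<C_H$ then $\displaystyle\limsup_{|x|\to\infty}\frac{|x|^{\bar\alpha_\lambda}}{v(x)}>0$, while if $\lambda=C_H$ then for every $\tau>0$ $$\limsup_{|x|\to\infty}\frac{|x|^{\frac{p-N}{p}}(\log|x|)^{2/p}(\log\log|x|)^\tau}{v(x)}>0.$$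
   Context: $\Delta_p u=\nabla\cdot(|\nabla u|^{p-2}\nabla u)$. $B]r_0,\infty[=\{x\in\mathbb{R}^N:|x|>r_0\}$, $B[r_0,\infty[=\{x:|x|\ge r_0\}$. A $C^2$-supersolution is a function $w\in C^2(B[r_0,\infty[)$ with $-\Delta_p w-\lambda|x|^{-p}|w|^{p-2}w\ge 0$ pointwise in $B]r_0,\infty[$. A radial function $v(x)=\phi(|x|)$ is strictly monotone decreasing if $\phi'(r)<0$ for all $r\ge r_0$. (For $0<\lambda<C_H$ there are exactly two such roots, for $\lambda=C_H$ they coincide and equal $\frac{p-N}{p}$, and for $\lambda=0$ they are $\frac{p-N}{p-1}$ and $0$.) *)

(* Defs.v *)
From HB Require Import structures.
From mathcomp Require Import all_boot all_order all_algebra.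
From mathcomp Require Import all_classical all_reals all_analysis.
Set Implicit Arguments. Unset Strict Implicit. Unset Printing Implicit Defensive.
Import Order.TTheory GRing.Theory Num.Theory.
Import numFieldNormedType.Exports.
Local Open Scope classical_set_scope.
Local Open Scope ring_scope.

Section PLap.
Variables (R : realType) (N : nat).
Notation V := 'rV[R]_N.

Definition ebase (i : 'I_N) : V := delta_mx 0 i.

(* Euclidean norm |x| (the library norm on matrices is the sup norm) *)
Definition enorm (x : V) : R := Num.sqrt (\sum_(i < N) x 0 i ^+ 2).

Definition pd (i : 'I_N) (f : V -> R) (x : V) : R := 'D_(ebase i) f x.

Definition grad (f : V -> R) (x : V) : V := \row_(i < N) pd i f x.

Definition flux (p : R) (w : V -> R) (i : 'I_N) (y : V) : R :=
  enorm (grad w y) `^ (p - 2) * pd i w y.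

Definition plap (p : R) (w : V -> R) (x : V) : R :=
  \sum_(i < N) pd i (flux p w i) x.

Definition openB (r0 : R) : set V := [set x | r0 < enorm x].
Definition closedB (r0 : R) : set V := [set x | r0 <= enorm x].

(* w in C^2(B[r0,oo[): w is C^2 in the open exterior B]r0,oo[ (all partial
   derivatives of order <= 2 exist and are continuous there), and w together
   with its partial derivatives of order <= 2 extend continuously to the
   closed exterior B[r0,oo[. *)
Definition C2_closed_ext (r0 : R) (w : V -> R) : Prop :=
  (forall x, openB r0 x ->
     (forall i, derivable w x (ebase i)) /\
     (forall i j, derivable (pd i w) x (ebase j)) /\
     (forall i j, {for x, continuous (pd j (pd i w))})) /\
  {within closedB r0, continuous w} /\
  (forall i, exists g : V -> R, {within closedB r0, continuous g} /\
       (forall x, openB r0 x -> g x = pd i w x)) /\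
  (forall i j, exists g : V -> R, {within closedB r0, continuous g} /\
       (forall x, openB r0 x -> g x = pd j (pd i w) x)).

(* C^2-supersolution of  -Delta_p u - lambda |x|^(-p) |u|^(p-2) u = 0
   in B]r0,oo[ (the p-Laplacian being taken pointwise, i.e. the flux
   components are required to be partially differentiable). *)
Definition supersol (p lambda r0 : R) (w : V -> R) : Prop :=
  C2_closed_ext r0 w /\
  forall x, openB r0 x ->
    (forall i, derivable (flux p w i) x (ebase i)) /\
    0 <= - plap p w x - lambda * enorm x `^ (- p) * (`|w x| `^ (p - 2) * w x).

Definition radial_strict_decr (r0 : R) (v : V -> R) : Prop :=
  exists phi : R -> R,
    (forall x, closedB r0 x -> v x = phi (enorm x)) /\
    (forall r, r0 <= r -> derivable phi r 1 /\ derive1 phi r < 0).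

Definition limsup_infty_pos (f : V -> R) : Prop :=
  exists eps : R, 0 < eps /\ forall M : R, exists x, M < enorm x /\ eps < f x.

End PLap.

Definition Falpha (R : realType) (N : nat) (p a : R) : R :=
  a * (`|a| `^ (p - 2)) * (p - N%:R - (p - 1) * a).

Definition CH (R : realType) (N : nat) (p : R) : R := `|(p - N%:R) / p| `^ p.

(* Main.v *)
Require Import Defs.
From HB Require Import structures.
From mathcomp Require Import all_boot all_order all_algebra.
From mathcomp Require Import all_classical all_reals all_analysis.
From mathcomp Require Import ring lra.
Import Order.TTheory GRing.Theory Num.Theory.
Import numFieldNormedType.Exports.
Local Open Scope classical_set_scope.
Local Open Scope ring_scope.

(** Idea. Along a radial function [U] with [U' < 0] put [Y = - r U' / U]. Then
    [U] is a supersolution iff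
    [(p - 1) r Y' >= (p - 1) Y^2 - (N - p) Y + lambda Y^(2 - p)], and if [- B] is
    a root of [Falpha = lambda] and [m = N - p - (p - 1) B], convexity of
    [Y^(2 - p)] bounds the right-hand side below by [(p - 1) (m - Y) (B - Y)].

    (a) With [B = - al >= m], this makes [r^(- B - e) - R^(- e) r^(- B)] a strict
    subsolution on [0 < r < R]. A supersolution cannot be touched from below by
    a multiple of it: there the gradients agree, are nonzero, and the Hessians
    are ordered. Hence the maximum over [r0 <= |x| <= R] of the quotient
    (barrier / w) is attained on [|x| = r0], and one takes [R] large and [e]
    small depending on [x].

    (b) A radial supersolution touches itself, so its [Y] satisfies the same
    differential inequality. If [lambda < CH] then, for [B = - ab < m],
    [r Y' >= (m - B) (B - Y)], so [B - Y <= K r^(- (m - B))] is integrable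
    against [dr / r] and [v r^B] is bounded. If [lambda = CH] then [m = B], and
    the second-order expansion gives [r Y' >= (p / 2) (B - Y)^2] when [Y <= B],
    so [B - Y <= (2 / p) / (ln r + const)] and [v r^B] is [O((ln r)^(2 / p))]. *)

(** * Derivatives of functions given pointwise *)

Section PointwiseDerivatives.
Set Implicit Arguments. Unset Strict Implicit.
Context {R : realType} {V : normedModType R}.
Implicit Types (f g : V -> R) (x v : V) (df dg : R).

Lemma is_derive_fctD f g x v df dg :
  is_derive x v f df -> is_derive x v g dg ->
  is_derive x v (fun y => f y + g y) (df + dg).
Proof. exact: is_deriveD. Qed.

Lemma is_derive_fctB f g x v df dg :
  is_derive x v f df -> is_derive x v g dg ->
  is_derive x v (fun y => f y - g y) (df - dg).
Proof. exact: is_deriveB. Qed.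

Lemma is_derive_fctM f g x v df dg :
  is_derive x v f df -> is_derive x v g dg ->
  is_derive x v (fun y => f y * g y) (df * g x + f x * dg).
Proof.
move=> hf hg; apply: is_derive_eq (is_deriveM hf hg) _.
by rewrite addrC [_ *: df]mulrC.
Qed.

Lemma is_derive_fctMl (k : R) f x v df :
  is_derive x v f df -> is_derive x v (fun y => k * f y) (k * df).
Proof. exact: is_deriveZ. Qed.

Lemma is_derive_fct_sqr f x v df :
  is_derive x v f df -> is_derive x v (fun y => f y ^+ 2) (2 * f x * df).
Proof. exact: (@is_deriveX _ _ f 2). Qed.

Lemma is_derive_fct_sum n (f : 'I_n -> V -> R) x v (df : 'I_n -> R) :
  (forall i, is_derive x v (f i) (df i)) ->
  is_derive x v (fun y => \sum_i f i y) (\sum_i df i).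
Proof.
move=> h; have := is_derive_sum h.
by congr (is_derive x v _ _); apply/funext => y; rewrite fct_sumE.
Qed.

(** Both sides have the same difference quotient as a function of [h]. This carries one-variable
    calculus over to directional derivatives, with no Fréchet differentiability of [f]. *)
Lemma is_derive_line f x v df :
  is_derive x v f df <-> is_derive (0 : R) 1 (fun t : R => f (t *: v + x)) df.
Proof.
have E : (fun h : R => h^-1 *: ((f \o shift x) (h *: v) - f x)) =
  (fun h : R => h^-1 *: (((fun t : R => f (t *: v + x)) \o shift 0) (h *: 1)
                         - f (0 *: v + x))).
  by apply/funext => h; rewrite /= addr0 scale0r add0r [h *: 1]mulr1.
split=> -[d1 d2]; (split; [move: d1; rewrite /derivable E|
                           move: d2; rewrite /derive E]) => //.
Qed.

Lemma is_derive_comp1 (h : R -> R) f x v dh df :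
  is_derive (f x) 1 h dh -> is_derive x v f df ->
  is_derive x v (fun y => h (f y)) (dh * df).
Proof.
move=> hh /is_derive_line hf; apply/is_derive_line.
apply: (@is_derive1_comp _ h (fun t : R => f (t *: v + x))) => //.
by rewrite scale0r add0r.
Qed.

End PointwiseDerivatives.

(** * Lower bounds for the right-hand side of the Riccati inequality *)

Section RiccatiInequalities.
Set Implicit Arguments. Unset Strict Implicit.
Context {R : realType}.
Implicit Types B Y p q m : R.

(** Convexity of Y^(-q): write (Y/B)^(-q) as exp(-q ln(Y/B)), then apply exp z >= 1 + z and ln t <=
    t - 1. *)
Lemma powRN_ge_tangent q B Y : 0 <= q -> 0 < B -> 0 < Y ->
  B `^ (- q) * (1 - q * ((Y - B) / B)) <= Y `^ (- q).
Proof.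
move=> q0 B0 Y0.
have YB : 0 < Y / B by rewrite divr_gt0.
rewrite {2}(_ : Y = B * (Y / B)); last by rewrite mulrC divfK// gt_eqF.
rewrite powRM ?(ltW B0) ?(ltW YB)// ler_wpM2l ?powR_ge0//.
rewrite [leRHS]/powR gt_eqF// mulNr.
have h : ln (Y / B) <= Y / B - 1.
  have := @le_ln1Dx R (Y / B - 1); rewrite subrKC; apply; lra.
apply: le_trans (expR_ge1Dx _); rewrite lerD2l lerN2 ler_wpM2l//.
by apply: le_trans h _; rewrite mulrBl divff ?gt_eqF.
Qed.

(** Replacing Y^(2 - p) by its tangent at [B] leaves a quadratic in [Y] whose roots are exactly [m]
    and [B]. The coefficients are those of the equation when lambda = B^(p - 1) m and N - p = m + (p
    - 1) B. *)
Lemma riccati_rhs_ge p B Y m : 2 <= p -> 0 < B -> 0 < Y -> 0 <= m ->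
  (p - 1) * ((m - Y) * (B - Y)) <=
  (p - 1) * Y ^+ 2 - (m + (p - 1) * B) * Y + B `^ (p - 1) * m * Y `^ (2 - p).
Proof.
move=> p2 B0 Y0 m0.
have q0 : 0 <= p - 2 by lra.
have := powRN_ge_tangent q0 B0 Y0; rewrite opprB => h.
have := ler_wpM2l (mulr_ge0 (powR_ge0 B (p - 1)) m0) h.
have E : B `^ (p - 1) * B `^ (2 - p) = B.
  rewrite -powRD ?(gt_eqF B0) ?implybT//.
  by rewrite (_ : p - 1 + (2 - p) = 1); [rewrite powRr1 ?(ltW B0)|ring].
have -> X : B `^ (p - 1) * m * (B `^ (2 - p) * X) =
    B `^ (p - 1) * B `^ (2 - p) * m * X by ring.
rewrite E => {}h.
suff -> : (p - 1) * ((m - Y) * (B - Y)) =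
  (p - 1) * Y ^+ 2 - (m + (p - 1) * B) * Y +
    B * m * (1 - (p - 2) * ((Y - B) / B)) by lra.
by field; rewrite gt_eqF.
Qed.

Lemma ln_onem_le (x : R) : 0 <= x -> x < 1 -> ln (1 - x) <= - (x + x ^+ 2 / 2).
Proof.
move=> x0 x1.
pose f (t : R) : R := ln (1 - t) + (t + t ^+ 2 / 2).
have df (t : R) : t < 1 -> is_derive t 1 f (- (t ^+ 2 / (1 - t))).
  move=> t1; have t1' : 0 < 1 - t by lra.
  have dl := is_derive1_ln t1'.
  have dlg : is_derive t 1 (fun t : R => ln (1 - t)) ((1 - t)^-1 * (0 - 1)).
    exact: (is_derive1_comp (g := fun t : R => 1 - t)).
  by apply: is_derive_eq; rewrite /GRing.scale/=; field; rewrite gt_eqF.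
have f0 : f 0 = 0 by rewrite /f subr0 ln1 expr0n/= mul0r !addr0.
suff : f x <= f 0 by rewrite f0 /f -lerBrDr sub0r.
apply: (@ler0_derive1_nincr R f 0 x) => // t.
- by rewrite in_itv/= => /andP[_ tx]; have [] := df t (lt_trans tx x1).
- rewrite in_itv/= => /andP[t0 tx]; rewrite derive1E.
  have t1 := lt_trans tx x1.
  have [_ ->] := df t t1.
  by rewrite oppr_le0 divr_ge0 ?sqr_ge0//; lra.
- apply: derivable_within_continuous => {}t; rewrite in_itv/= => /andP[_ tx].
  by have [] := df t (le_lt_trans tx x1).
Qed.

Lemma expR_ge_quad (z : R) : 0 <= z -> 1 + z + z ^+ 2 / 2 <= expR z.
Proof.
move=> z0.
pose f (t : R) : R := expR t - (1 + t + t ^+ 2 / 2).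
have df (t : R) : is_derive t 1 f (expR t - (1 + t)).
  by apply: is_derive_eq; rewrite /GRing.scale/=; field.
have f0 : f 0 = 0 by rewrite /f expR0 expr0n/= mul0r !addr0 subrr.
rewrite -subr_ge0 -f0 -/(f z).
apply: (@ger0_derive1_ndecr R f 0 z) => // t.
- by move=> _; rewrite derive1E; have [_ ->] := df t; rewrite subr_ge0 expR_ge1Dx.
- by apply: derivable_within_continuous => {}t _; have [] := df t.
Qed.

(* Third-order terms in the expansion of [Y `^ (2 - p)] around [B] are
   nonnegative for [Y <= B]; the constant [p * (p - 1) / 2] is sharp and yields
   the exponent [2 / p] of the logarithm. *)
Lemma riccati_rhs_critical_ge p B Y : 2 <= p -> 0 < Y -> Y <= B ->
  p * (p - 1) / 2 * (B - Y) ^+ 2 <=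
  (p - 1) * Y ^+ 2 - p * B * Y + B `^ p * Y `^ (2 - p).
Proof.
move=> p2 Y0 YB.
have B0 : 0 < B by lra.
pose x := 1 - Y / B.
have YE : Y = B * (1 - x) by rewrite /x opprB addrC subrK mulrC divfK// gt_eqF.
have x0 : 0 <= x by rewrite /x subr_ge0 ler_pdivrMr// mul1r.
have x1 : x < 1 by rewrite /x ltrBlDr ltrDl divr_gt0.
have h : 1 + (p - 2) * x + (p - 2) * (p - 1) / 2 * x ^+ 2 <= (1 - x) `^ (2 - p).
  rewrite /powR gt_eqF ?subr_gt0//.
  (* With (1 - x)^(2 - p) = exp(-(p - 2) ln(1 - x)) >= exp z >= 1 + z + z^2/2 and z >= (p - 2) x,
     the coefficient of x^2 is at least (p - 2)/2 + (p - 2)^2/2 = (p - 2)(p - 1)/2. *)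
  pose z := (p - 2) * (x + x ^+ 2 / 2).
  have z0 : 0 <= z by apply: mulr_ge0; [lra|nra].
  have h1 : z <= (2 - p) * ln (1 - x).
    by rewrite /z; have := ln_onem_le x0 x1; nra.
  apply: (@le_trans _ _ (expR z)); last by rewrite ler_expR.
  apply: le_trans (expR_ge_quad z0).
  have : (p - 2) * x <= z.
    by rewrite /z ler_wpM2l//; [lra|nra].
  have : 0 <= (p - 2) * x by apply: mulr_ge0 => //; lra.
  move=> y0 yz; have : ((p - 2) * x) ^+ 2 <= z ^+ 2 by rewrite ler_pXn2r ?nnegrE.
  by move: (z ^+ 2) => z2; rewrite /z; lra.
have -> : B `^ p * Y `^ (2 - p) = B ^+ 2 * (1 - x) `^ (2 - p).
  rewrite YE powRM ?(ltW B0)//; last by lra.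
  rewrite mulrA -powRD ?(gt_eqF B0) ?implybT//.
  by rewrite (_ : p + (2 - p) = 2%:R); [rewrite powR_mulrn ?ltW|ring].
have := ler_wpM2l (sqr_ge0 B) h; rewrite {1 2 3}YE => {}h.
by apply: le_trans (lerD (lexx _) h); rewrite le_eqVlt; apply/orP; left; apply/eqP; field.
Qed.

End RiccatiInequalities.

(** * Directional derivatives and second-order conditions *)

Section DirectionalDerivatives.
Set Implicit Arguments. Unset Strict Implicit.
Context {R : realType}.

(** If [d2] were negative, [dg] would be negative just to the right of 0, and the mean value theorem
    would put [g] below its minimum. Only differentiability of [dg] at 0 enters, not continuity of a
    second derivative. *)
Lemma second_derivative_at_min (g dg : R -> R) (d2 e : R) : 0 < e ->
  (forall t : R, `|t| < e -> is_derive t 1 g (dg t)) -> is_derive (0 : R) 1 dg d2 ->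
  (forall t : R, `|t| < e -> g 0 <= g t) -> dg 0 = 0 /\ 0 <= d2.
Proof.
move=> e0 hg hdg gmin.
have inE (t : R) : t \in `]- e, e[%R = (`|t| < e).
  by rewrite in_itv/= ltr_norml.
have dg0 : dg 0 = 0.
  have h0 : `|0 : R| < e by rewrite normr0.
  have [_ <-] := hg 0 h0.
  have [] // := @derive1_at_min R g (- e) e 0.
  - by rewrite lerNl; lra.
  - by move=> t; rewrite inE => /hg[].
  - by rewrite inE.
  - by move=> t; rewrite inE; exact: gmin.
split=> //; rewrite leNgt; apply/negP => d20.
have [] := hdg; rewrite /derivable /derive => /[swap] dE /cvg_ex[l hl].
have lE := cvg_lim (@Rhausdorff R) hl; move: hl; rewrite -lE dE => hl {l lE}.
have : \forall h \near 0^', h^-1 *: ((dg \o shift 0) (h *: 1) - dg 0) < 0.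
  by apply: cvgr_lt hl _ d20.
rewrite near_withinE => /nbhs_ballP[d /= d0 hd].
pose t := Num.min d e / 2.
have t0 : 0 < t by rewrite divr_gt0// lt_min d0.
have md : Num.min d e <= d by rewrite ge_min lexx.
have me : Num.min d e <= e by rewrite ge_min lexx orbT.
have td : t < d by rewrite /t; lra.
have te : t < e by rewrite /t; lra.
have [s|s|c] := @MVT R g dg 0 t t0.
- rewrite in_itv/= => /andP[s0 st]; apply: hg.
  by rewrite gtr0_norm//; lra.
- apply: derivable_within_continuous => {}s; rewrite in_itv/= => /andP[s0 st].
  by have [] // := hg s; rewrite ger0_norm//; lra.
rewrite in_itv/= subr0 => /andP[c0 ct] E.
have : g 0 <= g t by apply: gmin; rewrite gtr0_norm.
rewrite -subr_ge0 E pmulr_lge0// leNgt => /negP; apply.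
have := hd c; rewrite /ball/= sub0r normrN gtr0_norm// => /(_ _ _)/=.
rewrite dg0 subr0 addr0 [c *: 1]mulr1 => H.
have : c^-1 * dg c < 0 by apply: H; [lra|rewrite gt_eqF].
by rewrite pmulr_rlt0 ?invr_gt0.
Qed.

Lemma is_derive_scale_dir {V : normedModType R} (f : V -> R) x v df k :
  is_derive x v f df -> is_derive x (k *: v) f (k * df).
Proof.
move=> /is_derive_line hf; apply/is_derive_line.
have -> : (fun t : R => f (t *: (k *: v) + x)) =
    (fun t : R => f (t *: v + x)) \o (fun t : R => k * t).
  by apply/funext => t /=; rewrite scalerA mulrC.
rewrite mulrC; apply: is_derive1_comp; first by rewrite mulr0.
by apply: is_derive_eq (is_deriveZ k (is_derive_id (0 : R) 1)) _; rewrite [_ *: 1]mulr1.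
Qed.

Lemma is_derive_along_line {V : normedModType R} (f : V -> R) x v df (t : R) :
  is_derive (t *: v + x) v f df -> is_derive t 1 (fun s : R => f (s *: v + x)) df.
Proof.
move=> /is_derive_line hf.
have -> : (fun s : R => f (s *: v + x)) =
    (fun s : R => f (s *: v + (t *: v + x))) \o (fun s : R => s - t).
  by apply/funext => s /=; rewrite addrA -scalerDl subrK.
rewrite -[df]mulr1; apply: is_derive1_comp; first by rewrite subrr.
by apply: is_derive_eq; rewrite subr0.
Qed.

Context {N : nat}.
Implicit Types (f : 'rV[R]_N -> R) (x v : 'rV[R]_N).

(** The increment splits into one along [v] and a last leg along the basis vector. On that leg the
    mean value theorem produces the partial derivative at an intermediate point, and its continuity
    at [x] gives the limit. *)
Lemma is_derive_add_ebase f x v i c l : is_derive x v f l ->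
  (\forall y \near x, derivable f y (ebase R i)) ->
  {for x, continuous (pd i f)} ->
  is_derive x (c *: ebase R i + v) f (c * pd i f x + l).
Proof.
move=> hv hi ci; set w := c *: ebase R i.
have key : h^-1 *: (f (h *: w + (h *: v + x)) - f (h *: v + x))
    @[h --> (0:R)^'] --> c * pd i f x.
  apply/cvgrPdist_le => /= e e0.
  have e1 : 0 < e / (`|c| + 1) by rewrite divr_gt0// ltr_wpDl.
  have ci' : \forall y \near x, `|pd i f x - pd i f y| <= e / (`|c| + 1).
    by move/cvgrPdist_le: ci; apply.
  have /nbhs_ballP[d /= d0 hd] : \forall y \near x,
      derivable f y (ebase R i) /\ `|pd i f x - pd i f y| <= e / (`|c| + 1).
    by near=> y; split; near: y.
  have M0 : 0 < `|w| + `|v| + 1 by rewrite ltr_wpDl// addr_ge0.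
  near=> h.
  have h0 : h != 0 by near: h; exact: nbhs_dnbhs_neq.
  (* This keeps the whole last leg inside the ball of radius [d] about [x]. *)
  have hM : `|h| * (`|w| + `|v| + 1) < d.
    rewrite -ltr_pdivlMr//; near: h; apply: dnbhs0_lt; exact: divr_gt0.
  pose y s := s *: (h *: w) + (h *: v + x).
  have yd (s : R) : 0 <= s -> s <= 1 ->
      derivable f (y s) (ebase R i) /\
      `|pd i f x - pd i f (y s)| <= e / (`|c| + 1).
    move=> s0 s1; apply: hd; rewrite -ball_normE/= /y addrA opprD addrCA.
    rewrite subrr addr0 normrN (le_lt_trans (ler_normD _ _))//.
    apply: le_lt_trans hM; rewrite (normrZ s) (normrZ h w) (normrZ h v).
    rewrite (ger0_norm s0).
    have := ler_piMl (mulr_ge0 (normr_ge0 h) (normr_ge0 w)) s1.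
    by have := normr_ge0 h; lra.
  have dy (s : R) : 0 <= s -> s <= 1 ->
      is_derive s 1 (fun s => f (y s)) (h * (c * pd i f (y s))).
    move=> s0 s1; have [/derivableP ys _] := yd s s0 s1.
    exact/is_derive_along_line/is_derive_scale_dir/is_derive_scale_dir.
  have [|s|s|s] := @MVT R (fun s => f (y s)) (fun s => h * (c * pd i f (y s))) 0 1.
  - exact: ltr01.
  - by rewrite in_itv/= => /andP[s0 s1]; apply: dy; exact: ltW.
  - apply: derivable_within_continuous => {}s; rewrite in_itv/= => /andP[s0 s1].
    by have [] := dy s s0 s1.
  rewrite in_itv/= => /andP[/ltW s0 /ltW s1].
  rewrite {1 2}/y scale1r scale0r add0r subr0 mulr1 => ->.
  rewrite /GRing.scale/= mulKf// -mulrBr normrM.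
  have [_ hs] := yd s s0 s1.
  have := ler_wpM2l (normr_ge0 c) hs; move/le_trans; apply.
  rewrite mulrCA ler_piMr ?(ltW e0)// ler_pdivrMr ?mul1r ?lerDl//.
have E : (fun h : R => h^-1 *: ((f \o shift x) (h *: (w + v)) - f x)) =
  (fun h : R => h^-1 *: (f (h *: w + (h *: v + x)) - f (h *: v + x))) \+
  (fun h : R => h^-1 *: ((f \o shift x) (h *: v) - f x)).
  apply/funext => h /=; rewrite (scalerDr h) -(addrA (h *: w)).
  move: (f _) (f _) (f _) => a b k.
  by rewrite -scalerDr addrA subrK.
have hl : h^-1 *: ((f \o shift x) (h *: (w + v)) - f x) @[h --> (0:R)^'] -->
    c * pd i f x + l.
  rewrite E; apply: cvgD key _.
  case: hv; rewrite /derivable /derive => /cvg_ex[k hk] <-.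
  by rewrite (cvg_lim (@Rhausdorff R) hk).
split; first by apply/cvg_ex; exists (c * pd i f x + l).
exact: cvg_lim.
Unshelve. all: by end_near. Qed.

(** Basis directions are added one at a time, so that partial derivatives, which are all that
    [C2_closed_ext] provides, control every direction. *)
Lemma is_derive_of_partials f x v :
  (forall i, \forall y \near x, derivable f y (ebase R i)) ->
  (forall i, {for x, continuous (pd i f)}) ->
  is_derive x v f (\sum_i v 0 i * pd i f x).
Proof.
move=> hd hc; rewrite {1}[v]row_sum_delta.
elim/big_rec2 : _ => [|i l u _ hu]; first exact: is_derive0.
exact: is_derive_add_ebase.
Qed.

End DirectionalDerivatives.

(** * The Euclidean norm and the p-Laplacian *)

Section EuclideanNorm.
Set Implicit Arguments. Unset Strict Implicit.
Context {R : realType} {N : nat}.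
Implicit Types (x v : 'rV[R]_N) (i j : 'I_N).

Lemma sum_ebasel i (a : 'I_N -> R) : \sum_k ebase R i 0 k * a k = a i.
Proof.
rewrite (bigD1 i)//= big1 ?addr0 => [|k ki].
  by rewrite /ebase mxE !eqxx mul1r.
by rewrite /ebase mxE eqxx (negPf ki) mul0r.
Qed.

Lemma sum_ebaser i (a : 'I_N -> R) : \sum_k a k * ebase R i 0 k = a i.
Proof. by rewrite -[RHS](sum_ebasel i a); apply: eq_bigr => k _; rewrite mulrC. Qed.

Lemma enorm_ge0 x : 0 <= enorm x. Proof. exact: sqrtr_ge0. Qed.

Lemma enorm_sqr x : enorm x ^+ 2 = \sum_i x 0 i ^+ 2.
Proof. by rewrite sqr_sqrtr// sumr_ge0// => i _; exact: sqr_ge0. Qed.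

Lemma enorm_ebase i (s : R) : 0 <= s -> enorm (s *: ebase R i) = s.
Proof.
move=> s0; rewrite /enorm -[RHS](ger0_norm s0) -sqrtr_sqr; congr Num.sqrt.
rewrite -(sum_ebasel i (fun=> s ^+ 2)); apply: eq_bigr => k _.
rewrite mxE exprMn mulrC; congr (_ * _).
by rewrite /ebase mxE eqxx/=; case: (_ == _); rewrite ?expr1n ?expr0n.
Qed.

Lemma coord_le_enorm x i : `|x 0 i| <= enorm x.
Proof.
rewrite -sqrtr_sqr ler_wsqrtr// (bigD1 i)//= lerDl sumr_ge0// => k _.
exact: sqr_ge0.
Qed.

Lemma continuous_enorm : continuous (@enorm R N).
Proof.
have cS : continuous (fun x : 'rV[R]_N => \sum_(i < N) x 0 i ^+ 2).
  apply: continuous_big => [|i _ y]; first exact: add_continuous.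
  exact: (continuous_comp (@coord_continuous R 1 N 0 i y)
                          (@exprn_continuous R 2 _)).
by move=> x; apply: (continuous_comp (cS x)); exact: sqrt_continuous.
Qed.

Lemma open_openB r0 : open (@openB R N r0).
Proof.
rewrite (_ : openB r0 = @enorm R N @^-1` [set r | r0 < r]) //.
by apply: open_comp; [move=> x _; exact: continuous_enorm|exact: open_gt].
Qed.

Lemma near_openB r0 x : openB r0 x -> \forall y \near x, openB r0 y.
Proof. by move=> xB; apply: open_nbhs_nbhs; split=> //; exact: open_openB. Qed.

(** Boundedness refers to the sup norm, which the Euclidean norm dominates; closedness comes from
    continuity of [enorm]. *)
Lemma compact_annulus (a b : R) :
  compact [set x : 'rV[R]_N | a <= enorm x <= b].
Proof.
apply: bounded_closed_compact.
  exists b; split; first exact: num_real.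
  move=> M bM x /= /andP[_ xb].
  have M0 : 0 <= M by apply: (le_trans (enorm_ge0 x)); apply: le_trans xb (ltW bM).
  rewrite [leLHS]/Num.norm/= mx_normrE; apply/bigmax_leP; split=> // -[i j] _ /=.
  rewrite ord1; apply: le_trans (coord_le_enorm _ _) _.
  exact: le_trans xb (ltW bM).
rewrite (_ : mkset _ = @enorm R N @^-1` [set r | a <= r <= b]) //.
apply: preimage_closed; first by move=> x _; exact: continuous_enorm.
by rewrite -set_itvcc; exact: itv_closed.
Qed.

(** Stated for a vector of functions so as to serve both for |x|, with coordinates as [F], and for
    the length of the gradient, with partial derivatives as [F]. *)
Lemma is_derive_enorm_row {V : normedModType R} (F : 'I_N -> V -> R) (x v : V)
    (dF : 'I_N -> R) :
  (forall j, is_derive x v (F j) (dF j)) -> 0 < enorm (\row_j F j x) ->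
  is_derive x v (fun y => enorm (\row_j F j y))
    ((\sum_j F j x * dF j) / enorm (\row_j F j x)).
Proof.
move=> hF; set G := enorm _ => G0.
have E y : enorm (\row_j F j y) = Num.sqrt (\sum_j F j y ^+ 2).
  by rewrite /enorm; congr Num.sqrt; apply: eq_bigr => j _; rewrite mxE.
have S0 : 0 < \sum_j F j x ^+ 2.
  by rewrite -sqrtr_gt0 -E.
have dS : is_derive x v (fun y => \sum_j F j y ^+ 2) (\sum_j 2 * F j x * dF j).
  by apply: is_derive_fct_sum => j; exact: is_derive_fct_sqr.
have := is_derive_comp1 (is_derive1_sqrt S0) dS; rewrite -E -/G.
rewrite (_ : (fun y => Num.sqrt _) = (fun y => enorm (\row_j F j y))); last first.
  by apply/funext => y; rewrite E.
move/is_derive_eq; apply.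
rewrite (eq_bigr (fun j => 2 * (F j x * dF j))); last by move=> j _; rewrite mulrA.
by rewrite -mulr_sumr; field; rewrite gt_eqF.
Qed.

Lemma is_derive_coord x v i : is_derive x v (fun y : 'rV[R]_N => y 0 i) (v 0 i).
Proof.
apply/is_derive_line.
rewrite (_ : (fun t : R => _) = (fun t : R => v 0 i * t + x 0 i)); last first.
  by apply/funext => t; rewrite !mxE mulrC.
apply: is_derive_eq (is_derive_fctD (is_derive_fctMl (v 0 i) (is_derive_id _ _))
  (is_derive_cst _ _ _)) _.
by rewrite addr0 mulr1.
Qed.

Lemma is_derive_enorm x v : 0 < enorm x ->
  is_derive x v (@enorm R N) ((\sum_i x 0 i * v 0 i) / enorm x).
Proof.
have E (y : 'rV[R]_N) : \row_j y 0 j = y by apply/rowP => j; rewrite mxE.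
move=> x0; have := is_derive_enorm_row (F := fun j (y : 'rV[R]_N) => y 0 j)
  (is_derive_coord x v).
rewrite E => /(_ x0); congr (is_derive _ _ _ _).
by apply/funext => y; rewrite E.
Qed.

End EuclideanNorm.

Section PLaplacian.
Set Implicit Arguments. Unset Strict Implicit.
Context {R : realType} {N : nat}.
Implicit Types (w : 'rV[R]_N -> R) (x v : 'rV[R]_N) (i j : 'I_N).

(** The non-divergence form, by the product rule at a point where the gradient is nonzero: a
    Laplacian plus p - 2 times the second derivative in the unit gradient direction. *)
Lemma plapE (p : R) w x :
  (forall i j, derivable (pd i w) x (ebase R j)) -> 0 < enorm (grad w x) ->
  plap p w x = enorm (grad w x) `^ (p - 2) *
    (\sum_i pd i (pd i w) x + (p - 2) / enorm (grad w x) ^+ 2 *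
      \sum_i pd i w x * \sum_j pd j w x * pd i (pd j w) x).
Proof.
move=> hd; set G := enorm _ => G0.
rewrite mulrDr [X in _ + X]mulrA 2!mulr_sumr -big_split/=.
apply: eq_bigr => i _; rewrite /pd.
have dG : is_derive x (ebase R i) (fun y => enorm (grad w y))
    ((\sum_j pd j w x * pd i (pd j w) x) / G).
  by apply: is_derive_enorm_row => // j; exact: derivableP.
have dP := is_derive_comp1 (f := fun y => enorm (grad w y))
  (is_derive1_powR (p - 2) G0) dG.
have [_ ->] := is_derive_fctM dP (derivableP (hd i i)).
rewrite -/G addrC /pd; congr (_ + _).
have -> : p - 2 - 1 = (p - 2) - 2%:R + 1 by ring.
rewrite powRD ?(gt_eqF G0) ?implybT// powRB ?(gt_eqF G0) ?implybT//.
rewrite powR_mulrn ?(ltW G0)// powRr1 ?(ltW G0)//.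
by field; rewrite gt_eqF.
Qed.

(** In [C2_closed_ext] continuity is asked outright only of the second partials; for the first ones
    it is inherited from their continuous extension [g], with which they agree near [x]. *)
Lemma C2_ext_continuous r0 w i x : C2_closed_ext r0 w -> openB r0 x ->
  {for x, continuous (pd i w)}.
Proof.
move=> [_ [_ [/(_ i)[g [gc gE]] _]]] xB.
have := continuous_subspaceW (_ : openB r0 `<=` closedB r0) gc.
move=> /(_ (fun y (h : openB r0 y) => ltW h)).
rewrite continuous_open_subspace; last exact: open_openB.
move=> /(_ x); rewrite inE => /(_ xB) gx.
suff : pd i w y @[y --> x] --> g x by rewrite gE.
apply: cvg_trans gx; apply: (near_eq_cvg (F := nbhs x)).
by apply: filterS (near_openB xB) => y; exact: gE.
Qed.

Lemma C2_ext_is_derive r0 w x v : C2_closed_ext r0 w -> openB r0 x ->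
  is_derive x v w (\sum_i v 0 i * pd i w x).
Proof.
move=> w2 xB; apply: is_derive_of_partials => i.
  by apply: filterS (near_openB xB) => y /(proj1 w2 y)[].
exact: C2_ext_continuous w2 xB.
Qed.

Lemma C2_ext_is_derive2 r0 w x v i : C2_closed_ext r0 w -> openB r0 x ->
  is_derive x v (pd i w) (\sum_j v 0 j * pd j (pd i w) x).
Proof.
move=> [w2 _] xB; apply: is_derive_of_partials => j.
  by apply: filterS (near_openB xB) => y /w2[_ [+ _]]; exact.
by have [_ [_]] := w2 x xB; exact.
Qed.

End PLaplacian.

(** * Radial functions touching a supersolution from below *)

Section Touching.
Set Implicit Arguments. Unset Strict Implicit.
Context {R : realType} {N : nat}.
Variables (r0 mu d2U : R) (w : 'rV[R]_N -> R) (x : 'rV[R]_N) (U dU : R -> R).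
Hypotheses (r0_gt0 : 0 < r0) (w2 : C2_closed_ext r0 w) (xB : openB r0 x).
Hypotheses (dUE : \forall s \near enorm x, is_derive (s : R) 1 U (dU s))
  (d2UE : is_derive (enorm x) 1 dU d2U).
Hypotheses (touch_near : \forall y \near x, mu * U (enorm y) <= w y)
  (touch_at : w x = mu * U (enorm x)).

Let r := enorm x.

(** On the line through [x] in direction [v], the difference of [w] and the scaled radial function
    has a local minimum 0 at [x]. The bracket is the second derivative of U(|x + t v|) at t = 0. *)
Lemma touching_derivatives (v : 'rV[R]_N) (a := \sum_i x 0 i * v 0 i) :
  \sum_i v 0 i * pd i w x = mu * (dU r * (a / r)) /\
  mu * (d2U * (a / r) ^+ 2 + dU r * (enorm v ^+ 2 / r - a ^+ 2 / r ^+ 3)) <=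
  \sum_i v 0 i * \sum_j v 0 j * pd j (pd i w) x.
Proof.
have r_gt0 : 0 < r by apply: lt_trans xB.
pose dg y := \sum_i v 0 i * pd i w y -
  mu * (dU (enorm y) * ((\sum_i y 0 i * v 0 i) / enorm y)).
have hdg y : openB r0 y -> is_derive (enorm y) 1 U (dU (enorm y)) ->
    is_derive y v (fun y => w y - mu * U (enorm y)) (dg y).
  move=> yB hU; apply: is_derive_fctB; first exact: C2_ext_is_derive w2 yB.
  apply: is_derive_fctMl; apply: is_derive_comp1 hU _.
  by apply: is_derive_enorm; apply: lt_trans yB.
have hdg2 : is_derive x v dg (\sum_i v 0 i * \sum_j v 0 j * pd j (pd i w) x -
   mu * (d2U * (a / r) ^+ 2 + dU r * (enorm v ^+ 2 / r - a ^+ 2 / r ^+ 3))).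
  apply: is_derive_fctB.
    apply: is_derive_fct_sum => i; apply: is_derive_fctMl.
    exact: C2_ext_is_derive2 w2 xB.
  apply: is_derive_fctMl.
  have dn := is_derive_enorm v r_gt0.
  have da : is_derive x v (fun y : 'rV[R]_N => \sum_i y 0 i * v 0 i)
      (\sum_i v 0 i * v 0 i).
    apply: is_derive_fct_sum => i.
    apply: is_derive_eq (is_derive_fctM (is_derive_coord x v i)
      (is_derive_cst (v 0 i) x v)) _.
    by rewrite mulr0 addr0.
  have di := is_derive_comp1 (h := GRing.inv) (f := @enorm R N) (x := x).
  have dinv : is_derive (enorm x) 1 (GRing.inv : R -> R) (- r ^- 2).
    apply: is_derive_eq (is_deriveV _ (is_derive_id _ _)) _.
      by rewrite gt_eqF.
    by rewrite [_ *: 1]mulr1.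
  apply: is_derive_eq (is_derive_fctM (is_derive_comp1 d2UE dn)
    (is_derive_fctM da (di _ _ _ dinv dn))) _.
  rewrite -/r -/a (_ : \sum_i v 0 i * v 0 i = enorm v ^+ 2); last first.
    by rewrite enorm_sqr; apply: eq_bigr => i _; rewrite expr2.
  by field; rewrite gt_eqF.
have /nbhs_ballP[d /= d0 hd] : \forall y \near x,
    [/\ openB r0 y, is_derive (enorm y) 1 U (dU (enorm y)) &
        mu * U (enorm y) <= w y].
  have h1 := near_openB xB.
  have h2 : \forall y \near x, is_derive (enorm y) 1 U (dU (enorm y)).
    exact: (@continuous_enorm R N x _ dUE).
  by near=> y; split; near: y.
pose e := d / (`|v| + 1).
have v1 : 0 < `|v| + 1 by rewrite ltr_wpDl.
have hball (t : R) : `|t| < e -> ball x d (t *: v + x).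
  move=> te; rewrite -ball_normE/= opprD addrCA subrr addr0 normrN normrZ.
  have : `|t| * (`|v| + 1) < d by rewrite -ltr_pdivlMr.
  by have := normr_ge0 t; lra.
have [] := @second_derivative_at_min R
  (fun t => w (t *: v + x) - mu * U (enorm (t *: v + x)))
  (fun t => dg (t *: v + x)) _ e (divr_gt0 d0 v1) _
  (proj1 (is_derive_line _ _ _ _) hdg2).
- move=> t /hball/hd[yB hU _].
  exact: is_derive_along_line (hdg _ yB hU).
- move=> t /hball/hd[_ _ h].
  by rewrite scale0r add0r touch_at subrr subr_ge0.
rewrite scale0r add0r subr_ge0 => /eqP; rewrite subr_eq0 => /eqP -> ->.
by split.
Unshelve. all: by end_near. Qed.

(** Touching makes the gradient of [w] a nonzero multiple of [x], so the non-divergence form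
    applies, and its two second-order terms are bounded below by those of the radial function. A
    common factor mu^(p - 1) then cancels. *)
Lemma touching_radial_ineq (p lambda : R) : 2 <= p ->
  supersol p lambda r0 w -> 0 < mu -> 0 < U r -> dU r < 0 ->
  lambda * r `^ (- p) * U r `^ (p - 1) <=
  (- dU r) `^ (p - 2) * - ((p - 1) * d2U + (N%:R - 1) / r * dU r).
Proof.
move=> p2 [_ /(_ x xB)[_]] + mu0 U0 dU0.
have r_gt0 : 0 < r by apply: lt_trans xB.
have gradE i : pd i w x = mu * dU r / r * x 0 i.
  have [+ _] := touching_derivatives (ebase R i).
  by rewrite sum_ebasel sum_ebaser => ->; field; rewrite gt_eqF.
have sqE (v : 'rV[R]_N) : \sum_i v 0 i * v 0 i = enorm v ^+ 2.
  by rewrite enorm_sqr; apply: eq_bigr => i _; rewrite expr2.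
have GE : enorm (grad w x) = - (mu * dU r).
  have -> : grad w x = (mu * dU r / r) *: x.
    by apply/rowP => i; rewrite !mxE gradE.
  rewrite /enorm (eq_bigr (fun i => (mu * dU r / r) ^+ 2 * x 0 i ^+ 2)); last first.
    by move=> i _; rewrite mxE exprMn.
  rewrite -mulr_sumr -enorm_sqr -exprMn sqrtr_sqr divfK ?gt_eqF//.
  by rewrite ltr0_norm// pmulr_rlt0.
have G0 : 0 < - (mu * dU r) by rewrite oppr_gt0 pmulr_rlt0.
rewrite plapE ?GE//; last by move=> i j; have [/(_ x xB)[_ []]] := w2.
(* Sum of the Hessian comparison over the basis directions, where the squares of the x_i / r add up
   to 1. *)
have lap : mu * (d2U + (N%:R - 1) / r * dU r) <= \sum_i pd i (pd i w) x.
  have -> : mu * (d2U + (N%:R - 1) / r * dU r) = \sum_i mu *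
    (d2U * (x 0 i / r) ^+ 2 +
     dU r * (enorm (ebase R i) ^+ 2 / r - x 0 i ^+ 2 / r ^+ 3)).
    rewrite -mulr_sumr big_split/= -!mulr_sumr; congr (mu * _).
    rewrite (eq_bigr (fun i => r ^- 2 * x 0 i ^+ 2)); last first.
      by move=> i _; rewrite exprMn exprVn mulrC.
    rewrite -mulr_sumr -enorm_sqr -/r sumrB.
    rewrite (eq_bigr (fun=> r^-1)); last first.
      move=> i _; rewrite -[ebase R i]scale1r enorm_ebase// expr1n mul1r//.
    rewrite sumr_const card_ord -mulr_suml -enorm_sqr -/r -mulr_natl.
    by field; rewrite gt_eqF.
  apply: ler_sum => i _.
  have [_] := touching_derivatives (ebase R i).
  by rewrite sum_ebasel sum_ebaser sum_ebasel.
(* In the direction [x] itself the term carrying [dU] vanishes. *)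
have hess : mu * (d2U * r ^+ 2) <= \sum_i x 0 i * \sum_j x 0 j * pd j (pd i w) x.
  have [_] := touching_derivatives x; rewrite sqE -/r.
  apply: le_trans; rewrite le_eqVlt; apply/orP; left; apply/eqP.
  by field; rewrite gt_eqF.
have -> : \sum_i pd i w x * \sum_j pd j w x * pd i (pd j w) x =
    (mu * dU r / r) ^+ 2 * \sum_i x 0 i * \sum_j x 0 j * pd j (pd i w) x.
  transitivity (\sum_i \sum_j pd i w x * (pd j w x * pd i (pd j w) x)).
    by apply: eq_bigr => i _; rewrite mulr_sumr.
  rewrite exchange_big/= mulr_sumr; apply: eq_bigr => j _.
  rewrite !mulr_sumr; apply: eq_bigr => i _.
  by rewrite !gradE; ring.
rewrite touch_at -/r.
have muU : 0 < mu * U r by exact: mulr_gt0.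
rewrite (gtr0_norm muU).
have -> : (mu * U r) `^ (p - 2) * (mu * U r) = (mu * U r) `^ (p - 1).
  by rewrite mulrC (_ : p - 2 = p - 1 - 1) ?mulr_powRB1 ?(ltW muU)//; [lra|ring].
set L := \sum_i _ in lap *; set H := \sum_i _ in hess *.
have -> : (p - 2) / (- (mu * dU r)) ^+ 2 * ((mu * dU r / r) ^+ 2 * H) =
    (p - 2) * (H / r ^+ 2).
  by field; rewrite ?(gt_eqF r_gt0) ?(gt_eqF mu0) ?(lt_eqF dU0).
have -> : (- (mu * dU r)) `^ (p - 2) = mu `^ (p - 2) * (- dU r) `^ (p - 2).
  by rewrite -mulrN powRM ?(ltW mu0)// oppr_ge0 ltW.
have -> : (mu * U r) `^ (p - 1) = mu `^ (p - 1) * U r `^ (p - 1).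
  by rewrite powRM ?(ltW mu0) ?(ltW U0).
have -> : mu `^ (p - 1) = mu `^ (p - 2) * mu.
  by rewrite mulrC (_ : p - 2 = p - 1 - 1) ?mulr_powRB1 ?ltW//; [lra|ring].
have m0 : 0 < mu `^ (p - 2) by exact: powR_gt0.
move: m0; set M := mu `^ _ => m0.
rewrite subr_ge0 => h.
rewrite -(ler_pM2l (mulr_gt0 m0 mu0)).
have -> : M * mu * (lambda * r `^ (- p) * U r `^ (p - 1)) =
  lambda * r `^ (- p) * (M * mu * U r `^ (p - 1)) by ring.
apply: le_trans h _.
set P := (- dU r) `^ _.
have key : mu * ((p - 1) * d2U + (N%:R - 1) / r * dU r) <=
    L + (p - 2) * (H / r ^+ 2).
  have q0 : 0 <= p - 2 by lra.
  have hessr : mu * d2U <= H / r ^+ 2 by rewrite ler_pdivlMr ?exprn_gt0// -mulrA.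
  by have := ler_wpM2l q0 hessr; move: lap; lra.
have := ler_wpM2l (mulr_ge0 (ltW m0) (powR_ge0 (- dU r) (p - 2))) key.
by rewrite -/P; lra.
Qed.

End Touching.

(** * Comparison with the barrier *)

Section LowerBound.
Set Implicit Arguments. Unset Strict Implicit.
Context {R : realType}.

(* [Y = - r U' / U] and [Y + Y ^+ 2 - r ^+ 2 * U'' / U = r Y'], so the
   conclusion is the Riccati inequality for the logarithmic derivative. *)
Lemma radial_riccati (p lambda n r u du d2u : R) (Y := - (r * du) / u) :
  2 <= p -> 0 < r -> 0 < u -> du < 0 ->
  lambda * r `^ (- p) * u `^ (p - 1) <=
    (- du) `^ (p - 2) * - ((p - 1) * d2u + (n - 1) / r * du) ->
  (p - 1) * Y ^+ 2 - (n - p) * Y + lambda * Y `^ (2 - p) <=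
    (p - 1) * (Y + Y ^+ 2 - r ^+ 2 * d2u / u).
Proof.
move=> p2 r0 u0 du0 h.
have P0 : 0 < - du by rewrite oppr_gt0.
(* Multiplying by this factor removes the power of [- du] on the right and gathers the left-hand
   side into lambda Y^(2 - p). *)
have k0 : 0 < r ^+ 2 / u * (- du) `^ (2 - p).
  by rewrite mulr_gt0 ?powR_gt0// divr_gt0// exprn_gt0.
have := ler_wpM2l (ltW k0) h.
have -> : r ^+ 2 / u * (- du) `^ (2 - p) *
    (lambda * r `^ (- p) * u `^ (p - 1)) = lambda * Y `^ (2 - p).
  have -> : Y = r * (- du) / u by rewrite /Y mulrN.
  rewrite powRM ?invr_ge0 ?mulr_ge0 ?(ltW r0) ?(ltW u0) ?(ltW P0)//.
  rewrite powRM ?(ltW r0) ?(ltW P0)//.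
  rewrite (_ : r `^ (2 - p) = r ^+ 2 * r `^ (- p)); last first.
    by rewrite powRD ?(gt_eqF r0) ?implybT// powR_mulrn ?(ltW r0).
  rewrite (_ : u^-1 `^ (2 - p) = u `^ (p - 1) / u); last first.
    rewrite -powR_inv1 ?(ltW u0)// -powRrM.
    rewrite -powRD ?(gt_eqF u0) ?implybT//; congr (_ `^ _); ring.
  by ring.
have -> : r ^+ 2 / u * (- du) `^ (2 - p) * ((- du) `^ (p - 2) *
    - ((p - 1) * d2u + (n - 1) / r * du)) =
  - ((p - 1) * (r ^+ 2 * d2u / u)) + (n - 1) * Y.
  rewrite mulrA -[_ / u * _ * _]mulrA -powRD ?(gt_eqF P0) ?implybT//.
  rewrite (_ : 2 - p + (p - 2) = 0) ?powRr0; last by ring.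
  by rewrite /Y; field; rewrite ?gt_eqF.
by lra.
Qed.

(* The barrier [s `^ (- (B + e)) - Rr `^ (- e) * s `^ (- B)] vanishes at
   [s = Rr] and is a strict subsolution on [0 < s < Rr]. *)
Definition barrier (B e Rr s : R) : R :=
  s `^ (- (B + e)) - Rr `^ (- e) * s `^ (- B).

Definition dbarrier (B e Rr s : R) : R :=
  - (B + e) * s `^ (- (B + e) - 1) - Rr `^ (- e) * (- B * s `^ (- B - 1)).

Definition d2barrier (B e Rr s : R) : R :=
  - (B + e) * ((- (B + e) - 1) * s `^ (- (B + e) - 1 - 1)) -
  Rr `^ (- e) * (- B * ((- B - 1) * s `^ (- B - 1 - 1))).

Lemma is_derive_barrier (B e Rr s : R) : 0 < s ->
  is_derive s 1 (barrier B e Rr) (dbarrier B e Rr s).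
Proof.
move=> s0; apply: is_derive_fctB; first exact: is_derive1_powR.
by apply: is_derive_fctMl; exact: is_derive1_powR.
Qed.

Lemma is_derive_dbarrier (B e Rr s : R) : 0 < s ->
  is_derive s 1 (dbarrier B e Rr) (d2barrier B e Rr s).
Proof.
move=> s0; apply: is_derive_fctB.
  by apply: is_derive_fctMl; exact: is_derive1_powR.
by apply/is_derive_fctMl/is_derive_fctMl; exact: is_derive1_powR.
Qed.

(** * The barrier and its logarithmic derivative on 0 < r < Rr *)

Section BarrierValues.
Variables (B e Rr r : R).
Hypotheses (B0 : 0 < B) (e0 : 0 < e) (r_gt0 : 0 < r) (rR : r < Rr).
Let E := r `^ (- (B + e)).
Let S := Rr `^ (- e) * r `^ (- B).

Lemma barrier_coef : [/\ 0 < S, S < E & barrier B e Rr r = E - S].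
Proof.
have Rr0 := lt_trans r_gt0 rR.
split=> //; first by rewrite mulr_gt0 ?powR_gt0.
have -> : E = r `^ (- e) * r `^ (- B).
  by rewrite -powRD ?(gt_eqF r_gt0) ?implybT// -opprD addrC.
rewrite ltr_pM2r ?powR_gt0// !powRN ltf_pV2 ?posrE ?powR_gt0//.
by apply: gt0_ltr_powR => //; rewrite nnegrE ltW.
Qed.

Lemma dbarrierE : r * dbarrier B e Rr r = B * S - (B + e) * E.
Proof.
rewrite /dbarrier !powRB ?(gt_eqF r_gt0) ?implybT// !powRr1 ?(ltW r_gt0)//.
by rewrite -/E /S; field; rewrite gt_eqF.
Qed.

Lemma d2barrierE :
  r ^+ 2 * d2barrier B e Rr r = (B + e) * (B + e + 1) * E - B * (B + 1) * S.
Proof.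
rewrite /d2barrier !powRB ?(gt_eqF r_gt0) ?implybT// !powRr1 ?(ltW r_gt0)//.
by rewrite -/E /S; field; rewrite gt_eqF.
Qed.

Lemma barrier_gt0 : 0 < barrier B e Rr r.
Proof. by have [_ SE ->] := barrier_coef; rewrite subr_gt0. Qed.

Lemma dbarrier_lt0 : dbarrier B e Rr r < 0.
Proof.
have [S0 SE _] := barrier_coef; rewrite -(pmulr_rlt0 _ r_gt0) dbarrierE.
by have := mulr_gt0 e0 (lt_trans S0 SE); have := ltr_pM2l B0 S E; rewrite SE; lra.
Qed.

(** For the barrier, Y = B + e + s with s = e S / (E - S), and r Y' = s (e + s). The Riccati
    inequality would force (B - m + e + s)(e + s) <= s (e + s), impossible since B >= m and e >
    0. *)
Lemma barrier_strict (p m lambda : R) : 2 <= p -> 0 <= m -> m <= B ->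
  lambda = B `^ (p - 1) * m ->
  ~ lambda * r `^ (- p) * barrier B e Rr r `^ (p - 1) <=
    (- dbarrier B e Rr r) `^ (p - 2) *
    - ((p - 1) * d2barrier B e Rr r +
       (m + (p - 1) * B + p - 1) / r * dbarrier B e Rr r).
Proof.
move=> p2 m0 mB lamE /radial_riccati.
move=> /(_ p2 r_gt0 barrier_gt0 dbarrier_lt0).
have [S0 SE ->] := barrier_coef; rewrite dbarrierE d2barrierE.
set Y : R := - _ / _.
have ES0 : 0 < E - S by rewrite subr_gt0.
pose s := e * S / (E - S).
have s0 : 0 < s by rewrite divr_gt0// mulr_gt0.
have YE : Y = B + e + s.
  by rewrite /Y /s; field; rewrite gt_eqF.
have -> : Y + Y ^+ 2 - ((B + e) * (B + e + 1) * E - B * (B + 1) * S) / (E - S) =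
    s * (e + s).
  by rewrite YE /s; field; rewrite gt_eqF.
clearbody s Y.
have Y0 : 0 < Y by rewrite YE !addr_gt0.
have := riccati_rhs_ge p2 B0 Y0 m0; rewrite -lamE.
have -> : m + (p - 1) * B + p - p = m + (p - 1) * B by ring.
move=> h1 h2; have := le_trans h1 h2.
have p1 : 0 < p - 1 by lra.
rewrite ler_pM2l// YE => h.
have es0 : 0 < e + s by exact: addr_gt0.
have h3 : 0 <= (B - m) * (e + s) by rewrite mulr_ge0 ?subr_ge0 ?(ltW es0).
have h4 : 0 < e * (e + s) by exact: mulr_gt0.
by move: h h3 h4; lra.
Qed.

End BarrierValues.

Lemma supersol_ge_fast_decay (N : nat) (p r0 B m lambda : R)
    (w : 'rV[R]_N -> R) : (0 < N)%N ->
  2 <= p -> 0 < r0 -> 0 < B -> 0 <= m -> m <= B ->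
  N%:R - p = m + (p - 1) * B -> lambda = B `^ (p - 1) * m ->
  supersol p lambda r0 w -> (forall x, closedB r0 x -> 0 < w x) ->
  exists C : R, 0 < C /\ forall x, closedB r0 x -> enorm x `^ (- B) <= C * w x.
Proof.
case: N w => // N w _ p2 r0_gt0 B0 m0 mB NE lamE ws w0.
have [w2 _] := ws; have [_ [wc _]] := w2.
have wcA (a b : R) : r0 <= a ->
    {within [set x : 'rV[R]_N.+1 | a <= enorm x <= b], continuous w}.
  move=> ra; apply: continuous_subspaceW wc => x /= /andP[ax _].
  exact: le_trans ax.
pose ann (a b : R) := [set x : 'rV[R]_N.+1 | a <= enorm x <= b].
have sphere0 : ann r0 r0 !=set0.
  by exists (r0 *: ebase R 0); rewrite /ann/= enorm_ebase ?lexx// ltW.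
have [z zS zmin] := EVT_min_rV sphere0 (@compact_annulus R N.+1 r0 r0) (wcA _ _ (lexx _)).
have wz0 : 0 < w z by apply: w0; move: zS; rewrite inE => /andP[].
have {}zmin x : enorm x = r0 -> w z <= w x.
  by move=> xr; apply: zmin; rewrite inE /ann/= xr lexx.
(* The constant bounds barrier / w on the inner sphere, where [w z] is the minimum of [w]. It does
   not depend on [Rr], which can therefore be chosen after [x]. *)
have main (e Rr : R) (x : 'rV[R]_N.+1) : 0 < e -> r0 <= enorm x -> enorm x < Rr ->
    barrier B e Rr (enorm x) <= r0 `^ (- (B + e)) / w z * w x.
  move=> e0 rx xR.
  have rR : r0 < Rr by exact: le_lt_trans xR.
  have x0 : 0 < enorm x by exact: lt_le_trans rx.
  pose f (y : 'rV[R]_N.+1) := barrier B e Rr (enorm y) / w y.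
  have fc : {within ann r0 Rr, continuous f}.
    have ann0 y : ann r0 Rr y -> 0 < enorm y /\ 0 < w y.
      move=> /andP[ry _]; split; [exact: lt_le_trans ry|exact: w0].
    apply/subspace_continuousP => y yA; have [y0 wy0] := ann0 y yA.
    have /subspace_continuousP/(_ y yA) wcy := wcA r0 Rr (lexx _).
    apply: cvgM; last by apply: cvgV wcy; rewrite gt_eqF.
    apply: cvg_within_filter.
    apply: (continuous_comp (@continuous_enorm R _ y)).
    apply/differentiable_continuous/derivable1_diffP.
    by have [] := is_derive_barrier B e Rr y0.
  have annx : ann r0 Rr x by rewrite /ann/= rx ltW.
  have [y yA ymax] := EVT_max_rV (ex_intro _ x annx) (@compact_annulus R N.+1 r0 Rr) fc.
  have := ymax x (mem_set annx); rewrite /f ler_pdivrMr ?w0//.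
  move: yA; rewrite inE => /andP[ry yR].
  have wy0 : 0 < w y by exact: w0.
  have y0 : 0 < enorm y by exact: lt_le_trans ry.
  (* A maximum on the outer sphere is excluded: the barrier is 0 there but positive at [x]. *)
  have [yRr|yRr] := eqVneq (enorm y) Rr.
    have -> : barrier B e Rr (enorm y) = 0.
      rewrite /barrier yRr -powRD; last by rewrite -yRr (gt_eqF y0) implybT.
      by rewrite -opprD [e + B]addrC subrr.
    by rewrite !mul0r leNgt barrier_gt0.
  have {yRr}yR : enorm y < Rr by rewrite lt_neqAle yRr.
  have [yr0|yr0] := eqVneq (enorm y) r0.
    move/le_trans; apply; rewrite ler_pM2r ?w0// ler_pM ?invr_ge0 ?(ltW wy0)//.
    - by rewrite ltW// barrier_gt0.
    - by rewrite /barrier yr0 lerBlDr lerDl mulr_ge0 ?powR_ge0.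
    - by rewrite lef_pV2 ?posrE// zmin.
  have yB : openB r0 y by rewrite /openB/= lt_neqAle eq_sym yr0.
  have uy0 := barrier_gt0 B e0 y0 yR.
  (* At an interior maximum of the quotient, this multiple of the barrier touches [w] from below at
     [y], which [barrier_strict] forbids. *)
  pose mu := w y / barrier B e Rr (enorm y).
  have mu0 : 0 < mu by rewrite divr_gt0.
  exfalso.
  apply: (barrier_strict B0 e0 y0 yR p2 m0 mB lamE).
  have -> : m + (p - 1) * B + p - 1 = N.+1%:R - 1 by rewrite -NE; ring.
  apply: (touching_radial_ineq (mu := mu) r0_gt0 w2 yB) => //.
  - near=> s; apply: is_derive_barrier; near: s; exact: lt_nbhsr.
  - exact: is_derive_dbarrier.
  - have h1 : \forall t \near y, enorm t < Rr.
      exact: (@continuous_enorm R _ y _ (lt_nbhsl yR)).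
    near=> t; have tB : openB r0 t by near: t; exact: near_openB.
    have tR : enorm t < Rr by near: t.
    have wt0 : 0 < w t by apply: w0; exact: ltW.
    have := ymax t (mem_set _); rewrite /f /ann/= (ltW tB) (ltW tR) => /(_ isT).
    rewrite ler_pdivrMr// => /(ler_wpM2l (ltW mu0))/le_trans; apply.
    by rewrite le_eqVlt /mu; apply/orP; left; apply/eqP; field; rewrite !gt_eqF.
  - by rewrite /mu divfK// gt_eqF.
  - exact: dbarrier_lt0.
(* The 4 is 2 times 2: one factor because the barrier at [x] is half of |x|^(-(B + e)), one from
   (|x| / r0)^e <= 2. *)
have C0 : 0 < 4 * r0 `^ (- B) / w z.
  by rewrite !mulr_gt0 ?invr_gt0 ?powR_gt0.
exists (4 * r0 `^ (- B) / w z); split=> // x rx.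
have x0 : 0 < enorm x by exact: lt_le_trans rx.
have l0 : 0 <= ln (enorm x / r0) by rewrite ln_ge0// ler_pdivlMr ?mul1r.
have l20 : 0 < ln (2 : R) by rewrite ln_gt0// ltr1n.
(* Small enough for (|x| / r0)^e <= 2; the added 1 keeps the denominator positive when |x| = r0. The
   outer radius |x| 2^(1/e) then makes Rr^(-e) equal to |x|^(-e) / 2. *)
pose e := ln 2 / (1 + ln (enorm x / r0)).
have e0 : 0 < e by rewrite divr_gt0// ltr_wpDr.
have xR : enorm x < enorm x * 2 `^ e^-1.
  by rewrite ltr_pMr// /powR pnatr_eq0/= expR_gt1 mulr_gt0 ?invr_gt0.
have := main e _ x e0 rx xR.
have -> : barrier B e (enorm x * 2 `^ e^-1) (enorm x) =
    enorm x `^ (- B) * enorm x `^ (- e) / 2.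
  rewrite /barrier powRM ?powR_ge0 ?(ltW x0)// -powRrM mulrN mulVf ?gt_eqF//.
  by rewrite powR_inv1// opprD powRD ?(gt_eqF x0) ?implybT//; field.
rewrite opprD powRD ?(gt_eqF r0_gt0) ?implybT// => h.
have h2 : (enorm x / r0) `^ e <= 2.
  rewrite -[leRHS]lnK ?posrE// /powR gt_eqF ?divr_gt0// ler_expR /e.
  by rewrite mulrAC ler_pdivrMr ?ltr_wpDr// ler_wpM2l ?(ltW l20)// lerDr.
have xe0 : 0 < enorm x `^ e by exact: powR_gt0.
have -> : enorm x `^ (- B) =
    2 * enorm x `^ e * (enorm x `^ (- B) * enorm x `^ (- e) / 2).
  by rewrite (powRN _ e); field; rewrite gt_eqF.
apply: (@le_trans _ _ (2 * enorm x `^ e *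
    (r0 `^ (- B) * r0 `^ (- e) / w z * w x))).
  by rewrite ler_pM2l// mulr_gt0.
have -> : 2 * enorm x `^ e * (r0 `^ (- B) * r0 `^ (- e) / w z * w x) =
    2 * (enorm x / r0) `^ e * (r0 `^ (- B) / w z * w x).
  rewrite powRM ?invr_ge0 ?(ltW x0) ?(ltW r0_gt0)//.
  have -> : r0^-1 `^ e = r0 `^ (- e).
    by rewrite -powR_inv1 ?(ltW r0_gt0)// -powRrM mulN1r.
  by ring.
have -> : 4 * r0 `^ (- B) / w z * w x = 2 * 2 * (r0 `^ (- B) / w z * w x).
  by ring.
rewrite ler_pM2r ?ler_pM2l// mulr_gt0 ?w0// divr_gt0// powR_gt0//.
Unshelve. all: by end_near. Qed.

End LowerBound.

(** * Radial supersolutions *)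

Section RadialSupersolutions.
Set Implicit Arguments. Unset Strict Implicit.
Context {R : realType}.

Lemma nonincreasing_of_derive (f df : R -> R) (a : R) :
  (forall r, a <= r -> is_derive (r : R) 1 f (df r)) ->
  (forall r, a <= r -> df r <= 0) -> forall r, a <= r -> f r <= f a.
Proof.
move=> hf h0 r ar.
apply: (@ler0_derive1_nincr R f a r) => // [s|s|].
- by rewrite in_itv/= => /andP[/ltW/hf[]].
- by rewrite in_itv/= derive1E => /andP[/ltW sa _]; have [_ ->] := hf s sa; exact: h0.
- by apply: derivable_within_continuous => s; rewrite in_itv/= => /andP[/hf[]].
Qed.

Lemma nondecreasing_of_derive (f df : R -> R) (a : R) :
  (forall r, a <= r -> is_derive (r : R) 1 f (df r)) ->
  (forall r, a <= r -> 0 <= df r) -> forall r, a <= r -> f a <= f r.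
Proof.
move=> hf h0 r ar; rewrite -lerN2.
apply: (@nonincreasing_of_derive (fun s => - f s) (fun s => - df s) a) => // s sa.
  by have := hf s sa; exact: is_deriveN.
by rewrite oppr_le0 h0.
Qed.

(* [Y = - r phi' / phi] and [D = r Y'] as functions of [r]. *)
Section LogDerivative.
Variables (phi Y D : R -> R) (a B : R).
Hypotheses (a0 : 0 < a) (B0 : 0 < B).
Hypothesis phi_gt0 : forall r, a <= r -> 0 < phi r.
Hypothesis dphi : forall r, a <= r -> is_derive (r : R) 1 phi (- (Y r * phi r / r)).
Hypothesis dY : forall r, a <= r -> is_derive (r : R) 1 Y (D r / r).

Let logp r := ln (phi r) + B * ln r.

Let dlogp r : a <= r -> is_derive (r : R) 1 logp ((B - Y r) / r).
Proof.
move=> ar; have r0 : 0 < r by exact: lt_le_trans ar.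
apply: is_derive_eq.
  apply: is_derive_fctD.
    exact: is_derive_comp1 (is_derive1_ln (phi_gt0 ar)) (dphi ar).
  exact/is_derive_fctMl/is_derive1_ln.
by field; rewrite ?gt_eqF// phi_gt0.
Qed.

Let phi_powR r : a <= r -> phi r * r `^ B = expR (logp r).
Proof.
move=> ar; have r0 : 0 < r by exact: lt_le_trans ar.
by rewrite expRD lnK ?posrE ?phi_gt0// /powR gt_eqF.
Qed.

Lemma profile_le_linear (k : R) : 0 < k -> (forall r, a <= r -> 0 < Y r) ->
  (forall r, a <= r -> k * (B - Y r) <= D r) ->
  exists2 C, 0 < C & forall r, a <= r -> phi r * r `^ B <= C.
Proof.
move=> k0 Y0 hD.
have hY r : a <= r -> B - Y r <= B * a `^ k * r `^ (- k).
  move=> ar; have r0 : 0 < r by exact: lt_le_trans ar.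
  (* Integrating factor r^k for r Y' >= k (B - Y). *)
  have : a `^ k * (Y a - B) <= r `^ k * (Y r - B).
    apply: (@nondecreasing_of_derive (fun r => r `^ k * (Y r - B))
      (fun r => r `^ k / r * (k * (Y r - B) + D r)) a) => // s sa.
      have s0 : 0 < s by exact: lt_le_trans sa.
      apply: is_derive_eq.
        apply: is_derive_fctM; first exact: is_derive1_powR.
        exact: is_derive_fctB (dY sa) (is_derive_cst _ _ _).
      rewrite powRB ?(gt_eqF s0) ?implybT// powRr1 ?(ltW s0)//.
      by field; rewrite gt_eqF.
    have s0 : 0 < s by exact: lt_le_trans sa.
    rewrite mulr_ge0 ?divr_ge0 ?powR_ge0 ?(ltW s0)//.
    by have := hD s sa; lra.
  rewrite powRN ler_pdivlMr ?powR_gt0// => h.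
  have := mulr_gt0 (powR_gt0 k a0) (Y0 a (lexx a)); lra.
exists (expR (logp a + B * a `^ k / k * a `^ (- k))); first exact: expR_gt0.
move=> r ar; rewrite phi_powR// ler_expR.
have r0 : 0 < r by exact: lt_le_trans ar.
(* The added term is an antiderivative of minus the bound [hY] divided by [r], so it absorbs the
   growth of [logp]. *)
have : logp r + B * a `^ k / k * r `^ (- k) <=
    logp a + B * a `^ k / k * a `^ (- k).
  apply: (@nonincreasing_of_derive (fun r => logp r + B * a `^ k / k * r `^ (- k))
      (fun r => (B - Y r - B * a `^ k * r `^ (- k)) / r) a) => // s sa.
    have s0 : 0 < s by exact: lt_le_trans sa.
    apply: is_derive_eq.
      apply: is_derive_fctD (dlogp sa) _.
      by apply: is_derive_fctMl; exact: is_derive1_powR.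
    rewrite powRB ?(gt_eqF s0) ?implybT// powRr1 ?(ltW s0)//.
    by field; rewrite !gt_eqF.
  have s0 : 0 < s by exact: lt_le_trans sa.
  by rewrite ler_pdivrMr// mul0r subr_le0 hY.
apply: le_trans; rewrite lerDl mulr_ge0 ?powR_ge0// divr_ge0 ?(ltW k0)//.
by rewrite mulr_ge0 ?powR_ge0 ?(ltW B0).
Qed.

(** [Y] is nondecreasing. Once it reaches [B], the product phi r^B no longer grows. If it never
    does, X = B - Y is positive with r X' <= - k X^2, so 1/X - k ln r is nondecreasing and X is at
    most about 1 / (k ln r). *)
Lemma profile_le_quadratic (k : R) : 0 < k ->
  (forall r, a <= r -> 0 <= D r) ->
  (forall r, a <= r -> Y r <= B -> k * (B - Y r) ^+ 2 <= D r) ->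
  exists C b : R, 0 < C /\
    forall r, b <= r -> phi r * r `^ B <= C * ln r `^ k^-1.
Proof.
move=> k0 D0 hD.
have Ymono r s : a <= r -> r <= s -> Y r <= Y s.
  move=> ar; apply: (@nondecreasing_of_derive Y (fun r => D r / r) r) => t rt.
    by apply: dY; exact: le_trans rt.
  have at_ := le_trans ar rt.
  by rewrite divr_ge0 ?D0// ltW// (lt_le_trans a0).
have ln_ge (b r : R) : expR b <= r -> b <= ln r.
  by move=> br; rewrite -[b]expRK ler_ln// ?posrE ?expR_gt0// (lt_le_trans _ br) ?expR_gt0.
have [[b [ab Bb]]|noB] := pselect (exists b, a <= b /\ B <= Y b).
  exists (expR (logp b)), (Num.max b (expR 1)); split; first exact: expR_gt0.
  move=> r; rewrite ge_max => /andP[br /ln_ge lr].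
  rewrite phi_powR ?(le_trans ab)//; apply: (@le_trans _ _ (expR (logp b))).
    rewrite ler_expR; apply: (@nonincreasing_of_derive logp
      (fun r => (B - Y r) / r) b) => // s bs.
      by apply: dlogp; exact: le_trans bs.
    rewrite ler_pdivrMr ?mul0r ?subr_le0 ?(le_trans Bb) ?Ymono//.
    by rewrite (lt_le_trans a0) ?(le_trans ab).
  rewrite ler_pMr ?expR_gt0// -{1}(powRr0 (ln r)).
  by rewrite ler_powR// invr_ge0 ltW.
have YB r : a <= r -> Y r < B.
  by move=> ar; rewrite ltNge; apply/negP => h; apply: noB; exists r.
(* Chosen so that k T(a) = 1 / (B - Y a), which starts the comparison of 1/X with k T at
   equality. *)
pose c := (k * (B - Y a))^-1.
have c0 : 0 < c by rewrite invr_gt0 mulr_gt0// subr_gt0 YB.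
pose T r : R := ln r - ln a + c.
have T0 r : a <= r -> 0 < T r.
  move=> ar; rewrite ltr_wpDl// subr_ge0 ler_ln ?posrE//.
  exact: lt_le_trans ar.
have dT r : a <= r -> is_derive (r : R) 1 T r^-1.
  move=> ar; have r0 : 0 < r by exact: lt_le_trans ar.
  apply: is_derive_eq.
    apply: is_derive_fctD (is_derive_cst _ _ _).
    exact: is_derive_fctB (is_derive1_ln r0) (is_derive_cst _ _ _).
  by rewrite subr0 addr0.
have hX r : a <= r -> B - Y r <= (k * T r)^-1.
  move=> ar; have X0 s : a <= s -> 0 < B - Y s by move=> /YB; rewrite subr_gt0.
  have : (B - Y a)^-1 - k * T a <= (B - Y r)^-1 - k * T r.
    apply: (@nondecreasing_of_derive (fun r => (B - Y r)^-1 - k * T r)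
      (fun r => (D r / (B - Y r) ^+ 2 - k) / r) a) => // s sa.
      have s0 : 0 < s by exact: lt_le_trans sa.
      have dX : is_derive s 1 (fun s => B - Y s) (0 - D s / s).
        exact: is_derive_fctB (is_derive_cst _ _ _) (dY sa).
      have := @is_deriveV R (fun s => B - Y s) s _ 1.
      move=> /(_ _ _ dX) hi; apply: is_derive_eq.
        apply: is_derive_fctB (is_derive_fctMl k (dT s sa)).
        by apply: hi; rewrite gt_eqF ?X0.
      rewrite /GRing.scale/=; field.
      by rewrite gt_eqF//= gt_eqF ?X0.
    have s0 : 0 < s by exact: lt_le_trans sa.
    rewrite divr_ge0 ?(ltW s0)// subr_ge0 ler_pdivlMr ?exprn_gt0 ?X0//.
    by rewrite hD// ltW// YB.
  have -> : (B - Y a)^-1 - k * T a = 0.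
    by rewrite /T subrr add0r /c; field; rewrite !gt_eqF// X0.
  rewrite subr_ge0 => h; rewrite -[leLHS]invrK lef_pV2 ?posrE ?invr_gt0 ?X0//.
  by rewrite mulr_gt0// T0.
pose L0 := logp a - k^-1 * ln (T a).
(* Beyond this threshold ln r >= c - ln a, hence T r <= 2 ln r, which accounts for the factor
   2^(1/k). *)
exists (expR L0 * 2 `^ k^-1), (Num.max a (expR (Num.max 1 (c - ln a)))).
split; first by rewrite mulr_gt0 ?expR_gt0 ?powR_gt0.
move=> r; rewrite ge_max => /andP[ar /ln_ge]; rewrite ge_max => /andP[l1 lc].
have : logp r - k^-1 * ln (T r) <= L0.
  apply: (@nonincreasing_of_derive (fun r => logp r - k^-1 * ln (T r))
      (fun r => (B - Y r - (k * T r)^-1) / r) a) => // s sa.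
    have s0 : 0 < s by exact: lt_le_trans sa.
    apply: is_derive_eq.
      apply: is_derive_fctB (dlogp sa) _; apply: is_derive_fctMl.
      exact: is_derive_comp1 (is_derive1_ln (T0 s sa)) (dT s sa).
    by field; rewrite !gt_eqF// T0.
  have s0 : 0 < s by exact: lt_le_trans sa.
  by rewrite ler_pdivrMr// mul0r subr_le0 hX.
rewrite lerBlDr => hM; rewrite phi_powR//.
apply: (@le_trans _ _ (expR (L0 + k^-1 * ln (T r)))); first by rewrite ler_expR.
rewrite (expRD L0).
rewrite -mulrA ler_pM2l ?expR_gt0// -powRM ?(le_trans ler01 l1)//.
have -> : expR (k^-1 * ln (T r)) = T r `^ k^-1.
  by rewrite /powR gt_eqF ?T0.
rewrite ge0_ler_powR ?nnegrE ?invr_ge0 ?(ltW k0) ?(ltW (T0 r ar))//.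
  by rewrite mulr_ge0// (le_trans ler01 l1).
by rewrite /T; lra.
Qed.

End LogDerivative.

(** [phi] is given as once differentiable only; its second derivative is read off from [v] along the
    first axis, on the open exterior. The Riccati inequality follows since [v] touches itself with
    factor 1. *)
Lemma radial_profile (N : nat) (p lambda r0 : R) (v : 'rV[R]_N.+1 -> R)
    (phi : R -> R) (Y := fun r => - (r * derive1 phi r) / phi r) :
  2 <= p -> 0 < r0 -> supersol p lambda r0 v ->
  (forall x, closedB r0 x -> 0 < v x) ->
  (forall x, closedB r0 x -> v x = phi (enorm x)) ->
  (forall r, r0 <= r -> derivable phi r 1 /\ derive1 phi r < 0) ->
  exists D : R -> R, forall r, r0 < r ->
    [/\ 0 < phi r, is_derive r 1 phi (- (Y r * phi r / r)), 0 < Y r,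
      is_derive r 1 Y (D r / r) &
      (p - 1) * Y r ^+ 2 - (N.+1%:R - p) * Y r + lambda * Y r `^ (2 - p) <=
      (p - 1) * D r].
Proof.
move=> p2 r0_gt0 vs v0 vE hphi; have [v2 _] := vs.
pose e0 := ebase R (ord0 : 'I_N.+1).
pose d2 r := pd ord0 (pd ord0 v) (r *: e0).
exists (fun r => Y r + Y r ^+ 2 - r ^+ 2 * d2 r / phi r) => r rr0.
have r_gt0 : 0 < r by exact: lt_trans rr0.
have eE s : r0 < s -> enorm (s *: e0) = s.
  by move=> rs; rewrite enorm_ebase// ltW// (lt_trans r0_gt0).
have vline s : r0 < s -> v (s *: e0 + 0) = phi s.
  by move=> rs; rewrite addr0 vE /closedB/= eE// ltW.
have inB s : r0 < s -> openB r0 (s *: e0) by move=> rs; rewrite /openB/= eE.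
have phi0 : 0 < phi r.
  by rewrite -vline// addr0 v0// /closedB/= eE// ltW.
have [dphi dphi0] := hphi r (ltW rr0).
have hd1 s : r0 < s -> is_derive s 1 phi (derive1 phi s).
  by move=> rs; have [/derivableP] := hphi s (ltW rs); rewrite derive1E.
have nr s : r0 < s -> \forall t \near s, r0 < t by exact: lt_nbhsr.
have hpd s : r0 < s -> pd ord0 v (s *: e0 + 0) = derive1 phi s.
  move=> rs; have [/(_ _ (inB s rs))[/(_ ord0)/derivableP hv _] _] := v2.
  rewrite -[s *: e0]addr0 in hv.
  have := is_derive_along_line hv.
  move/(near_eq_is_derive (g := phi)) => /(_ _)[|_ dE]; last by rewrite derive1E dE.
  by apply: filterS (nr s rs) => t; exact: vline.
have hd2 : is_derive r 1 (derive1 phi) (d2 r).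
  have [/(_ _ (inB r rr0))[_ [/(_ ord0 ord0)/derivableP hv _]] _] := v2.
  rewrite -[r *: e0]addr0 in hv.
  have := is_derive_along_line hv; rewrite addr0.
  apply: near_eq_is_derive.
  by apply: filterS (nr r rr0) => t; exact: hpd.
split=> //.
- apply: is_derive_eq (hd1 r rr0) _; rewrite /Y; field.
  by rewrite !gt_eqF.
- by rewrite /Y divr_gt0// oppr_gt0 pmulr_rlt0.
- apply: is_derive_eq.
    have dn : is_derive r 1 (fun s => - (s * derive1 phi s))
        (- (1 * derive1 phi r + r * d2 r)).
      exact: is_deriveN (is_derive_fctM (is_derive_id r 1) hd2).
    have di := @is_deriveV R phi r _ 1 (lt0r_neq0 phi0) (hd1 r rr0).
    exact: is_derive_fctM dn di.
  rewrite /GRing.scale /Y/=; field.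
  by rewrite !gt_eqF.
- have xE : enorm (r *: e0) = r by exact: eE.
  apply: radial_riccati => //.
  have := @touching_radial_ineq R N.+1 r0 1 (d2 r) v (r *: e0) phi (derive1 phi).
  rewrite xE; apply=> //.
  + exact: inB.
  + by apply: filterS (nr r rr0) => t; exact: hd1.
  + apply: filterS (near_openB (inB r rr0)) => y yB.
    by rewrite mul1r vE//; exact: ltW.
  + by rewrite mul1r -(vline r)// addr0.
Qed.

Lemma limsup_infty_pos_axis (N : nat) (f : 'rV[R]_N.+1 -> R) (eps b : R) :
  0 < eps -> (forall r, b <= r -> eps < f (r *: ebase R ord0)) ->
  limsup_infty_pos f.
Proof.
move=> eps0 h; exists eps; split=> // M.
pose r := Num.max b (`|M| + 1).
have Mr : `|M| + 1 <= r by rewrite le_max lexx orbT.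
exists (r *: ebase R ord0); split; last by apply: h; rewrite le_max lexx.
rewrite enorm_ebase; last by rewrite (le_trans _ Mr)// addr_ge0.
by apply: lt_le_trans Mr; rewrite (le_lt_trans (ler_norm M))// ltrDl.
Qed.

End RadialSupersolutions.

(** * Roots of the characteristic equation *)

Section Roots.
Set Implicit Arguments. Unset Strict Implicit.
Context {R : realType}.
Variables (N : nat) (p : R).
Hypotheses (p2 : 2 <= p) (pN : p < N%:R).

Let p_gt0 : 0 < p. Proof. exact: lt_le_trans p2. Qed.
Let p1_gt0 : 0 < p - 1. Proof. by rewrite subr_gt0 (lt_le_trans _ p2)// ltr1n. Qed.
Let Np_gt0 : 0 < N%:R - p. Proof. by rewrite subr_gt0. Qed.

Let b0 : R := (N%:R - p) / p.
Let b1 : R := (N%:R - p) / (p - 1).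

(** In the variable b = - alpha the equation reads lambda = b^(p - 1) m with m = N - p - (p - 1) b,
    the form taken by [riccati_rhs_ge]. *)
Lemma Falpha_opp (b : R) : 0 < b ->
  Falpha N p (- b) = b `^ (p - 1) * (N%:R - p - (p - 1) * b).
Proof.
move=> b_gt0; rewrite /Falpha normrN (gtr0_norm b_gt0).
have -> : b `^ (p - 1) = b * b `^ (p - 2).
  by rewrite -(mulr_powRB1 (ltW b_gt0) p1_gt0); congr (_ * _ `^ _); ring.
by ring.
Qed.

Lemma crit_gt0 : 0 < b0. Proof. by rewrite divr_gt0. Qed.

Lemma crit_mul : p * b0 = N%:R - p.
Proof. by rewrite /b0; field; rewrite gt_eqF. Qed.

Lemma CH_crit : CH N p = b0 `^ p.
Proof.
rewrite /CH (_ : (p - N%:R) / p = - b0); last by rewrite /b0 -mulNr opprB.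
by rewrite normrN gtr0_norm// crit_gt0.
Qed.

Lemma Falpha_crit : Falpha N p (- b0) = CH N p.
Proof.
rewrite Falpha_opp ?crit_gt0// CH_crit -crit_mul.
have -> : p * b0 - (p - 1) * b0 = b0 by ring.
by rewrite mulrC mulr_powRB1 ?(ltW crit_gt0).
Qed.

Lemma Falpha_IVT (a b lambda : R) : 0 < a -> a <= b ->
  Num.min (Falpha N p (- a)) (Falpha N p (- b)) <= lambda ->
  lambda <= Num.max (Falpha N p (- a)) (Falpha N p (- b)) ->
  exists c, [/\ a <= c, c <= b & Falpha N p (- c) = lambda].
Proof.
move=> a0 ab; rewrite !Falpha_opp// ?(lt_le_trans a0)// => h1 h2.
pose G (c : R) := c `^ (p - 1) * (N%:R - p - (p - 1) * c).
have [||c] := @IVT R G a b lambda ab.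
- apply: derivable_within_continuous => c; rewrite in_itv/= => /andP[ac _].
  have c0 : 0 < c by exact: lt_le_trans ac.
  by apply: derivableM => //; apply: ex_derive; exact: is_derive1_powR.
- by rewrite h1.
rewrite in_itv/= => /andP[ac cb] Gc; exists c; split=> //.
by rewrite Falpha_opp// (lt_le_trans a0).
Qed.

Variables (lambda al ab : R).
Hypotheses (lambda0 : 0 <= lambda) (lambdaH : lambda <= CH N p).
Hypotheses (alab : al <= ab) (ab0 : ab <= 0).
Hypothesis roots : forall a, (p - N%:R) / (p - 1) <= a -> a <= 0 ->
  Falpha N p a = lambda -> a = al \/ a = ab.

Let b1E : (p - N%:R) / (p - 1) = - b1.
Proof. by rewrite /b1 -mulNr opprB. Qed.

Lemma crit_lt : b0 < b1.
Proof. by rewrite ltr_pM2l ?ltf_pV2 ?posrE// gtrBl ltr01. Qed.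

(** [Falpha] goes from [CH] at - b0 to 0 at - b1, so some root - c has c >= b0; whichever root it
    is, al <= ab gives c <= - al. For B = - al the conclusion says m <= B. *)
Lemma fast_root_le : b0 <= - al.
Proof.
have b1_gt0 := lt_trans crit_gt0 crit_lt.
have F1 : Falpha N p (- b1) = 0.
  rewrite Falpha_opp// (_ : N%:R - p - (p - 1) * b1 = 0) ?mulr0//.
  by rewrite /b1; field; rewrite gt_eqF.
have [||c [bc cb Fc]] := @Falpha_IVT b0 b1 lambda crit_gt0 (ltW crit_lt).
- by rewrite F1 ge_min lambda0 orbT.
- by rewrite Falpha_crit le_max lambdaH.
have c0 : 0 < c by exact: lt_le_trans crit_gt0 bc.
have [||E|E] := roots _ _ Fc.
- by rewrite b1E lerN2.
- by rewrite oppr_le0 ltW.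
- by rewrite -E opprK.
- by rewrite (le_trans bc)// lerNr E.
Qed.

(** For lambda = 0 the root is 0. Otherwise a root - c exists with c between a small [a] and [b0],
    and c differs from [b0] because the value there is [CH]. For B = - ab the conclusion says B <
    m. *)
Lemma slow_root_lt : lambda < CH N p -> - ab < b0.
Proof.
move=> lH; have [l0|l0] := eqVneq lambda 0.
  have F0 : Falpha N p 0 = lambda by rewrite /Falpha !mul0r l0.
  have b1_gt0 := lt_trans crit_gt0 crit_lt.
  suff -> : ab = 0 by rewrite oppr0 crit_gt0.
  have [|//|E|//] := roots _ _ F0; first by rewrite b1E oppr_le0 ltW.
  by apply/eqP; rewrite eq_le ab0 E alab.
have {}l0 : 0 < lambda by rewrite lt_neqAle eq_sym l0.
(* The second entry solves a^(p - 1) (N - p) = lambda, and a^(p - 1) (N - p) dominates [Falpha] at -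
   a. *)
pose a := Num.min b0 ((lambda / (N%:R - p)) `^ (p - 1)^-1).
have a0 : 0 < a by rewrite lt_min crit_gt0 powR_gt0 ?divr_gt0.
have ab0' : a <= b0 by rewrite ge_min lexx.
have Fa : Falpha N p (- a) <= lambda.
  rewrite Falpha_opp//; apply: (@le_trans _ _ (a `^ (p - 1) * (N%:R - p))).
    by rewrite ler_wpM2l ?powR_ge0// gerBl mulr_ge0 ?ltW.
  rewrite -ler_pdivlMr//.
  have -> : lambda / (N%:R - p) = ((lambda / (N%:R - p)) `^ (p - 1)^-1) `^ (p - 1).
    by rewrite -powRrM mulVf ?powRr1 ?(ltW (divr_gt0 _ _))// gt_eqF.
  rewrite ge0_ler_powR ?nnegrE ?powR_ge0 ?(ltW a0) ?(ltW p1_gt0)//.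
  by rewrite ge_min lexx orbT.
have [||c [ac cb Fc]] := @Falpha_IVT a b0 lambda a0 ab0'.
- by rewrite ge_min Fa.
- by rewrite Falpha_crit le_max lambdaH orbT.
have cb0 : c < b0.
  rewrite lt_neqAle cb andbT; apply: contraTneq lH => E.
  by rewrite -Fc E Falpha_crit ltxx.
have c0 : 0 < c by exact: lt_le_trans ac.
apply: le_lt_trans cb0; rewrite lerNl.
have [||->//|->//] := roots _ _ Fc; first by rewrite b1E lerN2 ltW// (le_lt_trans cb) ?crit_lt.
by rewrite oppr_le0 ltW.
Qed.

End Roots.

(** * Lower bound for all supersolutions, upper bounds for radial ones *)

Theorem theorem4p1 (R : realType) (N : nat) (p r0 lambda al ab : R) :
  (2 <= N)%N -> 2 <= p -> p < N%:R -> 0 < r0 ->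
  0 <= lambda -> lambda <= CH N p ->
  (* al <= ab are the roots in [(p-N)/(p-1), 0] of Falpha = lambda *)
  (p - N%:R) / (p - 1) <= al -> al <= ab -> ab <= 0 ->
  Falpha N p al = lambda -> Falpha N p ab = lambda ->
  (forall a, (p - N%:R) / (p - 1) <= a -> a <= 0 -> Falpha N p a = lambda ->
     a = al \/ a = ab) ->
  (* (a) *)
  (forall w : 'rV[R]_N -> R, supersol p lambda r0 w ->
     (forall x, closedB r0 x -> 0 < w x) ->
     exists C : R, 0 < C /\
       forall x, closedB r0 x -> enorm x `^ al <= C * w x) /\
  (* (b) *)
  (forall v : 'rV[R]_N -> R, supersol p lambda r0 v ->
     (forall x, closedB r0 x -> 0 < v x) -> radial_strict_decr r0 v ->
     (lambda < CH N p ->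
        limsup_infty_pos (fun x => enorm x `^ ab / v x)) /\
     (lambda = CH N p -> forall tau : R, 0 < tau ->
        limsup_infty_pos (fun x =>
          enorm x `^ ((p - N%:R) / p) * ln (enorm x) `^ (2 / p)
            * ln (ln (enorm x)) `^ tau / v x))).
Proof.
move=> N2 p2 pN r0_gt0 l0 lH al_ge alab ab0 Fal Fab roots.
have p0 : 0 < p by lra.
have p1 : 0 < p - 1 by lra.
have b0_gt0 := crit_gt0 p2 pN.
have b0p := crit_mul N p2.
have mge b : (p - N%:R) / (p - 1) <= - b -> 0 <= N%:R - p - (p - 1) * b.
  by rewrite ler_pdivrMr//; lra.
split=> [w ws w0|v vs v0 [phi [vE hphi]]].
  have alb := fast_root_le p2 pN l0 lH alab roots.
  have B0 : 0 < - al by exact: lt_le_trans alb.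
  have := @supersol_ge_fast_decay R N p r0 (- al) (N%:R - p - (p - 1) * - al)
    lambda w (ltnW N2) p2 r0_gt0 B0.
  rewrite opprK; apply=> //.
  - by apply: mge; rewrite opprK.
  - have := ler_wpM2l (ltW p0) alb; rewrite b0p; lra.
  - by ring.
  - by rewrite -Fal -[in LHS](opprK al) Falpha_opp.
case: N N2 pN lH al_ge Fal Fab roots b0_gt0 b0p mge v vs v0 vE => // N _ pN lH
  al_ge Fal Fab roots b0_gt0 b0p mge v vs v0 vE.
have [D hD] := radial_profile p2 r0_gt0 vs v0 vE hphi.
set Y := (fun r => - (r * derive1 phi r) / phi r) in hD.
(* The Riccati inequality is available only for r > r0, while the profile lemmas need a closed
   half-line. *)
pose a := r0 + 1.
have a0 : 0 < a by rewrite addr_gt0.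
have ra r : a <= r -> r0 < r by apply: lt_le_trans; rewrite ltrDl.
have phi0 r : a <= r -> 0 < phi r by move=> /ra/hD[].
have dphi r : a <= r -> is_derive r 1 phi (- (Y r * phi r / r)).
  by move=> /ra/hD[].
have Y0 r : a <= r -> 0 < Y r by move=> /ra/hD[].
have dY r : a <= r -> is_derive r 1 Y (D r / r) by move=> /ra/hD[].
have riccati r B m : a <= r -> 0 < B -> 0 <= m ->
    N.+1%:R - p = m + (p - 1) * B -> lambda = B `^ (p - 1) * m ->
    (m - Y r) * (B - Y r) <= D r.
  move=> ar B0 m0 NE lE; have [_ _ _ _] := hD r (ra r ar).
  rewrite NE lE; move/(le_trans (riccati_rhs_ge p2 B0 (Y0 r ar) m0)).
  by rewrite ler_pM2l.
have axis r : a <= r -> v (r *: ebase R ord0) = phi r.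
  move=> ar; have r_gt0 := lt_le_trans a0 ar.
  by rewrite vE /closedB/= enorm_ebase ?(ltW r_gt0)// ltW// ra.
split=> [lltH|lE tau tau0].
  (* [profile_le_linear] requires B > 0; for ab = 0 it is enough that [phi] decreases. *)
  have [B0|B0] := eqVneq ab 0.
    rewrite B0; apply: (@limsup_infty_pos_axis _ _ _ ((phi a)^-1 / 2) a).
      by rewrite divr_gt0 ?invr_gt0 ?phi0.
    move=> r ar; rewrite axis// powRr0 mul1r.
    have phia := phi0 a (lexx a).
    apply: (@lt_le_trans _ _ (phi a)^-1).
      by rewrite ltr_pdivrMr// ltr_pMr ?invr_gt0// ltr1n.
    rewrite lef_pV2 ?posrE ?phi0//.
    apply: (nonincreasing_of_derive dphi) => // s sa.
    have s0 : 0 < s by exact: lt_le_trans sa.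
    by rewrite oppr_le0 divr_ge0 ?(ltW s0)// mulr_ge0 ?(ltW (Y0 s sa)) ?(ltW (phi0 s sa)).
  have Bpos : 0 < - ab by rewrite oppr_gt0 lt_neqAle B0.
  have Blt := slow_root_lt p2 pN l0 lH alab ab0 roots lltH.
  pose m := N.+1%:R - p - (p - 1) * - ab.
  have mB : 0 < m - - ab.
    have := ltr_pM2l p0 (- ab) ((N.+1%:R - p) / p).
    by rewrite Blt b0p /m; lra.
  have m0 : 0 <= m by lra.
  have [r ar|C C0 hC] := profile_le_linear a0 Bpos phi0 dphi dY mB Y0.
    have := riccati r (- ab) m ar Bpos m0.
    rewrite -Fab -[in Falpha _ _ ab](opprK ab) Falpha_opp// => h.
    apply: le_trans (h _ _) => //; last by rewrite /m; ring.
    (* Uses (m - Y)(B - Y) = (m - B)(B - Y) + (B - Y)^2 with B = - ab. *)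
    have := sqr_ge0 (- ab - Y r); lra.
  apply: (@limsup_infty_pos_axis _ _ _ (C^-1 / 2) a).
    by rewrite divr_gt0 ?invr_gt0.
  move=> r ar; have r_gt0 := lt_le_trans a0 ar.
  rewrite axis// enorm_ebase ?(ltW r_gt0)//.
  apply: (@lt_le_trans _ _ C^-1).
    by rewrite ltr_pdivrMr// ltr_pMr ?invr_gt0// ltr1n.
  have -> : r `^ ab / phi r = (phi r * r `^ (- ab))^-1.
    by rewrite powRN invfM invrK mulrC.
  by rewrite lef_pV2 ?posrE ?hC// mulr_gt0 ?phi0 ?powR_gt0.
pose B := (N.+1%:R - p) / p.
have lB : lambda = B `^ p by rewrite lE CH_crit.
have lB1 : lambda = B `^ (p - 1) * B.
  by rewrite lB mulrC mulr_powRB1 ?(ltW b0_gt0)//; lra.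
have NB : N.+1%:R - p = B + (p - 1) * B by rewrite -b0p -/B; ring.
(* The rate k = p / 2 is what yields the exponent 1/k = 2 / p of the logarithm. *)
have k0 : 0 < p / 2 by lra.
have [r ar|r ar YB|C [b [C0 hC]]] :=
  profile_le_quadratic (B := B) a0 phi0 dphi dY k0.
- by apply: le_trans (riccati r B B ar b0_gt0 (ltW b0_gt0) NB lB1); rewrite -expr2 sqr_ge0.
- have [_ _ _ _] := hD r (ra r ar).
  have := riccati_rhs_critical_ge p2 (Y0 r ar) YB.
  rewrite -/B b0p -lB => /le_trans/[apply].
  have -> : p * (p - 1) / 2 * (B - Y r) ^+ 2 = (p - 1) * (p / 2 * (B - Y r) ^+ 2).
    by ring.
  by rewrite ler_pM2l.
pose b' := Num.max (Num.max a b) (expR (expR 1)).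
apply: (@limsup_infty_pos_axis _ _ _ (C^-1 / 2) b').
  by rewrite divr_gt0 ?invr_gt0.
move=> r; rewrite !ge_max -andbA => /and3P[ar br er].
have r_gt0 := lt_le_trans a0 ar.
rewrite axis// enorm_ebase ?(ltW r_gt0)//.
have l1 : expR 1 <= ln r by rewrite -[expR 1]expRK ler_ln// posrE expR_gt0.
have ln0 : 0 < ln r by apply: lt_le_trans l1; exact: expR_gt0.
have ll1 : 1 <= ln (ln r) by rewrite -[leLHS]expRK ler_ln// posrE expR_gt0.
apply: (@lt_le_trans _ _ C^-1).
  by rewrite ltr_pdivrMr// ltr_pMr ?invr_gt0// ltr1n.
apply: (@le_trans _ _ (r `^ ((p - N.+1%:R) / p) * ln r `^ (2 / p) / phi r)); last first.
  rewrite ler_pM2r ?invr_gt0 ?phi0// ler_pMr ?mulr_gt0 ?powR_gt0//.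
  by rewrite -{1}(powRr0 (ln (ln r))) ler_powR// ltW.
have -> : (p - N.+1%:R) / p = - B by rewrite /B -mulNr opprB.
have -> : r `^ (- B) * ln r `^ (2 / p) / phi r =
    ln r `^ (2 / p) / (phi r * r `^ B).
  by rewrite powRN; field; rewrite !gt_eqF ?phi0 ?powR_gt0.
rewrite ler_pdivlMr ?mulr_gt0 ?phi0 ?powR_gt0// [leLHS]mulrC ler_pdivrMr// [leRHS]mulrC.
by have := hC r br; rewrite invf_div.
Qed.
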